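(* Let $R$ be a real closed field and $A=R[x_1,\dots,x_n]$. Suppose that the Connectedness conjecture holds for $A$, i.e. for all $\alpha,\beta\in\mathrm{Sper}\,A$ and every finite collection $g_1,\dots,g_s$ of elements of $A\setminus\langle\alpha,\beta\rangle$ there exists a connected set $C\subset\mathrm{Sper}\,A$ such that $\alpha,\beta\in C$ and $C\cap\{g_i=0\}=\emptyset$ for all $i\in\{1,\dots,s\}$. Then the Pierce–Birkhoff conjecture holds for $A$, i.e. for every piecewise polynomial function $f:R^n\to R$ there is a finite family of polynomials $g_{ij}\in A$ such that $f=\sup_i\inf_j(g_{ij})$ as functions on $R^n$.
   Context: $\mathrm{Sper}\,A$ is the set of pairs $\alpha=(\mathfrak p_\alpha,\le_\alpha)$ with $\mathfrak p_\alpha$ a prime ideal of $A$ and $\le_\alpha$ a total ordering of $A/\mathfrak p_\alpha$; $f(\alpha)$ is the image of $f\in A$ in $A/\mathfrak p_\alpha$, and inequalities on $f(\alpha)$ refer to $\le_\alpha$. The spectral topology has basic open sets $\{\alpha: f_1(\alpha)>0,\dots,f_k(\alpha)>0\}$; ''connected'' refers to this topology. $\{g=0\}$ denotes $\{\alpha\in \mathrm{Sper}\,A: g(\alpha)=0\}$. The separating ideal $\langle\alpha,\beta\rangle$ is the ideal of $A$ generated by all $f\in A$ with $f(\alpha)\ge0$ and $f(\beta)\le0$. A function $f:R^n\to R$ is piecewise polynomial if $R^n$ is covered by finitely many closed semi-algebraic sets $P_i$ such that for each $i$ there is $f_i\in A$ with $f|_{P_i}=f_i|_{P_i}$. Known equivalence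 (Madden), used by the paper as the working form of the Pierce–Birkhoff conjecture: the Pierce–Birkhoff conjecture for $A$ is equivalent to the statement that for every piecewise polynomial $f$ and all $\alpha,\beta\in\mathrm{Sper}\,A$, $f_\alpha-f_\beta\in\langle\alpha,\beta\rangle$. Here $f_\alpha$ is a local polynomial representative of $f$ at $\alpha$: with $\{P_i\}$ a finite cover of $R^n$ by closed semi-algebraic sets and $f_i\in A$ polynomials such that $f|_{P_i}=f_i|_{P_i}$ for each $i$, and $\tilde P_i\subset\mathrm{Sper}\,A$ the constructible set defined by the same polynomial sign conditions as $P_i$, one picks $i$ with $\alpha\in\tilde P_i$ and sets $f_\alpha=f_i$. *)

(* Defs.v *)
From HB Require Import structures.
From mathcomp Require Import all_boot all_order all_algebra.
From mathcomp Require Import all_classical.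
From mathcomp Require Import interval_inference topology normedtype.
From mathcomp Require Import -(notations) mpoly.

Set Implicit Arguments.
Unset Strict Implicit.
Unset Printing Implicit Defensive.

Import Order.TTheory GRing.Theory Num.Theory.
Import numFieldNormedType.Exports.

Local Open Scope classical_set_scope.
Local Open Scope ring_scope.
Local Open Scope quotient_scope.

Record ring_total_order (Q : comNzRingType) (le : rel Q) : Prop :=
  RingTotalOrder {
    rto_refl : reflexive le;
    rto_anti : antisymmetric le;
    rto_trans : transitive le;
    rto_total : total le;
    rto_add : forall x y z, le x y -> le (x + z) (y + z);
    rto_mul : forall x y, le 0 x -> le 0 y -> le 0 (x * y)
  }.

(* [prime_idealr] includes properness and the closure axioms of an ideal. The
   predicate underlying [supp] and the relation [ord] are bool-valued, which is
   no restriction since classical logic is available. *)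
Record sper (A : comNzRingType) := Sper {
  supp : prime_idealr A;
  ord : rel {ideal_quot supp};
  ordP : ring_total_order ord
}.

Arguments ord {A} s _ _.

(* The value f(alpha), living in A / supp alpha. *)
Definition evalS (A : comNzRingType) (f : A) (alpha : sper A) :
  {ideal_quot (supp alpha)} := \pi f.

Definition ge0_at (A : comNzRingType) (f : A) (alpha : sper A) : Prop :=
  ord alpha 0 (evalS f alpha).
Definition le0_at (A : comNzRingType) (f : A) (alpha : sper A) : Prop :=
  ord alpha (evalS f alpha) 0.
Definition gt0_at (A : comNzRingType) (f : A) (alpha : sper A) : Prop :=
  ge0_at f alpha /\ evalS f alpha <> 0.

Definition zero_locus (A : comNzRingType) (g : A) : set (sper A) :=
  [set alpha | evalS g alpha = 0].

Definition basic_open (A : comNzRingType) (s : seq A) : set (sper A) :=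
  [set alpha | forall f, f \in s -> gt0_at f alpha].

Section SpectralTopology.
Variable A : comNzRingType.

HB.instance Definition _ := gen_eqMixin (sper A).
HB.instance Definition _ := gen_choiceMixin (sper A).

Let basic_cover : \bigcup_(U in range (@basic_open A)) id U = setT.
Proof.
by rewrite -subTset => a _; exists (basic_open [::]) => //; exists [::].
Qed.

Let basic_join (U V : set (sper A)) (a : sper A) :
  range (@basic_open A) U -> range (@basic_open A) V -> id U a -> id V a ->
  exists W, [/\ range (@basic_open A) W, id W a & id W `<=` id U `&` id V].
Proof.
move=> [s _ <-] [t _ <-] sa ta; exists (basic_open (s ++ t)); split.
- by exists (s ++ t).
- by move=> f; rewrite mem_cat => /orP[/sa|/ta].
- by move=> b bst; split=> f fs; apply: bst; rewrite mem_cat fs ?orbT.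
Qed.

HB.instance Definition _ :=
  isBaseTopological.Build (sper A) basic_cover basic_join.

End SpectralTopology.

Definition ideal_generated (A : comNzRingType) (S : set A) : set A :=
  [set x | exists (m : nat) (a s : 'I_m -> A),
     (forall i, S (s i)) /\ x = \sum_(i < m) a i * s i].

Definition separating_ideal (A : comNzRingType) (alpha beta : sper A) : set A :=
  ideal_generated [set f | ge0_at f alpha /\ le0_at f beta].

Definition connectedness_conjecture (A : comNzRingType) : Prop :=
  forall (alpha beta : sper A) (s : nat) (g : 'I_s -> A),
    (forall i, ~ separating_ideal alpha beta (g i)) ->
    exists C : set (sper A),
      [/\ connected C, C alpha, C beta &
          forall i, C `&` zero_locus (g i) = set0].

Definition peval (R : rcfType) (n : nat) (p : mpoly n R) (x : 'rV[R]_n) : R :=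
  meval (fun i => x ord0 i) p.

(* A pair of lists [(s, t)] encodes the system p = 0 (p in s), q > 0 (q in t). *)
Definition basic_semialgebraic (R : rcfType) (n : nat)
    (st : seq (mpoly n R) * seq (mpoly n R)) : set 'rV[R]_n :=
  [set x | (forall p, p \in st.1 -> peval p x = 0) /\
           (forall q, q \in st.2 -> 0 < peval q x)].

Definition semialgebraic (R : rcfType) (n : nat) (P : set 'rV[R]_n) : Prop :=
  exists L : seq (seq (mpoly n R) * seq (mpoly n R)),
    P = [set x | exists2 st, st \in L & basic_semialgebraic st x].

Definition piecewise_polynomial (R : rcfType) (n : nat)
    (f : 'rV[R]_n -> R) : Prop :=
  exists (m : nat) (P : 'I_m -> set 'rV[R]_n) (p : 'I_m -> mpoly n R),
    [/\ forall i, closed (P i) /\ semialgebraic (P i),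
        \bigcup_i P i = setT &
        forall i x, P i x -> f x = peval (p i) x].

(* Seeding with [F ord0], one of the terms, gives the maximum (resp. minimum)
   of a nonempty finite family without needing a bottom (resp. top) element. *)
Definition max_fin (R : rcfType) (m : nat) (F : 'I_m.+1 -> R) : R :=
  \big[Num.max/F ord0]_(i < m.+1) F i.
Definition min_fin (R : rcfType) (m : nat) (F : 'I_m.+1 -> R) : R :=
  \big[Num.min/F ord0]_(i < m.+1) F i.

Definition pierce_birkhoff_conjecture (R : rcfType) (n : nat) : Prop :=
  forall f : 'rV[R]_n -> R, piecewise_polynomial f ->
    exists (m k : nat) (g : 'I_m.+1 -> 'I_k.+1 -> mpoly n R),
      forall x, f x = max_fin (fun i => min_fin (fun j => peval (g i j) x)).

(* Main.v *)
Require Import Defs.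
From HB Require Import structures.
From mathcomp Require Import all_boot all_order all_algebra.
From mathcomp Require Import all_classical.
From mathcomp Require Import interval_inference topology normedtype.
From mathcomp Require Import -(notations) mpoly.
From mathcomp Require Import lra zify.
From mathcomp Require Import polyrcf.
From mathcomp Require polyorder qe_rcf_th qe_rcf.

(* Let f be given by polynomials p_i on a closed semialgebraic cover (P_i), with
   alpha in the constructible set of P_i and beta in that of P_j. Let J be the
   set of all k such that p_k - p_i is in <alpha, beta>. The differences p_k - p_l
   with k in J and l not in J are outside this ideal, so that some connected C
   containing alpha and beta avoids their zero sets. "Being in the set of some
   P_k with k in J" is a locally constant property on C, hence beta has it, and
   p_j - p_i is in the ideal.

   Local constancy reduces, by compactness, to a specialization gamma of delta.
   Take a point a over a real closed K realizing delta, and the convex subring of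
   K determined by gamma. A maximal subfield of that subring contains a point b
   infinitely close to a and realizing gamma, and a polynomial positive at gamma
   is positive on the whole segment [a, b]. Transfer to R gives a segment in R^n
   that meets no P_k and P_l (k in J, l not in J) simultaneously, although one
   end is in some P_k and the other one in some P_l; but a segment is connected.

   Finally, membership of f_beta - f_alpha in <alpha, beta> gives a polynomial
   h >= f_alpha at alpha with h <= f_beta at beta. Applied to the points of the
   real spectrum given by ultrafilters on R^n, together with the compactness of
   the space of ultrafilters, once for the infima and once for the supremum,
   this writes f as a finite sup of infs. *)

Set Implicit Arguments.
Unset Strict Implicit.
Unset Printing Implicit Defensive.

Import Order.TTheory GRing.Theory Num.Theory.
Import numFieldNormedType.Exports.

Local Open Scope classical_set_scope.
Local Open Scope ring_scope.
Local Open Scope quotient_scope.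

(** * Points of the real spectrum and ultraproducts *)

(** Each [P i] is described by equations and strict inequalities, so its closedness cannot be read
    off the constructible set [tilde]: it is a topological fact about R^n. A specialization is
    therefore brought back to R^n, where closedness can be used. For this its two ends must have
    coordinates in one field. The residue field of the convex subring is only a quotient and does
    not contain the coordinates of a; a maximal subfield is a copy of that residue field inside K,
    and this gives the segment from a to b a meaning.

    Since R may be non-Archimedean, its segments can be disconnected in the order topology. The
    connectedness that is used rests on the closedness of the [P i] and on the finite number of sign
    changes of a polynomial along a line. *)

Record prime_cone (A : comNzRingType) (P : A -> Prop) : Prop := PrimeCone {
  coneD : forall a b, P a -> P b -> P (a + b);
  coneM : forall a b, P a -> P b -> P (a * b);
  cone_total : forall a, P a \/ P (- a);
  coneN1 : ~ P (-1);
  cone_prime : forall a b, P (a * b) -> P (- (a * b)) ->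
    (P a /\ P (- a)) \/ (P b /\ P (- b))
}.

Section PrimeCone.
Variables (A : comNzRingType) (P : A -> Prop) (coneP : prime_cone P).

Lemma cone0 : P 0.
Proof. by case: (cone_total coneP 0); rewrite ?oppr0. Qed.

Lemma cone1 : P 1.
Proof. by case: (cone_total coneP 1) => // /(coneN1 coneP). Qed.

Lemma cone_mulN a b : P (- a) -> P (- b) -> P (a * b).
Proof. by move=> Pa Pb; rewrite -mulrNN; apply: (coneM coneP). Qed.

Definition cone_supp : pred A := fun a => `[< P a /\ P (- a) >].

Lemma cone_suppP a : reflect (P a /\ P (- a)) (a \in cone_supp).
Proof. exact: asboolP. Qed.

Fact cone_supp_idealr : idealr_closed cone_supp.
Proof.
split; first by apply/cone_suppP; rewrite oppr0; split; exact: cone0.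
  by apply/negP => /cone_suppP[_]; exact: (coneN1 coneP).
move=> a u v /cone_suppP[Pu PNu] /cone_suppP[Pv PNv]; apply/cone_suppP.
rewrite opprD; split; apply: (coneD coneP) => //.
  case: (cone_total coneP a) => Pa; first exact: (coneM coneP).
  exact: cone_mulN.
case: (cone_total coneP a) => Pa.
  by rewrite -mulrN; apply: (coneM coneP).
by rewrite -mulNr; apply: (coneM coneP).
Qed.

HB.instance Definition _ := isIdealr.Build A cone_supp cone_supp_idealr.

Fact cone_supp_prime : prime_idealr_closed cone_supp.
Proof.
move=> u v /cone_suppP[Puv PNuv]; apply/orP.
by case: (cone_prime coneP Puv PNuv) => h; [left|right]; apply/cone_suppP.
Qed.

HB.instance Definition _ := isPrimeIdealrClosed.Build A cone_supp cone_supp_prime.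

Definition cone_prime_idealr : prime_idealr A := cone_supp.

Definition cone_ord : rel {ideal_quot cone_prime_idealr} :=
  fun u v => `[< P (repr v - repr u) >].

Lemma cone_suppD a b : P a -> b - a \in cone_supp -> P b.
Proof. by move=> Pa /cone_suppP[Pba _]; rewrite -(subrK a b); apply: (coneD coneP). Qed.

Lemma cone_ordE a b :
  cone_ord (\pi a) (\pi b) <-> P (b - a).
Proof.
have pirepr c : repr (\pi_{ideal_quot cone_prime_idealr} c) - c \in cone_supp.
  by rewrite (Quotient.idealrBE cone_prime_idealr) reprK.
rewrite /cone_ord; set ra := repr (\pi a); set rb := repr (\pi b).
have suppB : (rb - ra) - (b - a) \in cone_supp.
  rewrite !opprB [a - b]addrC addrACA [- ra + a]addrC -[a - ra]opprB.
  exact: rpredB (pirepr b) (pirepr a).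
split=> [/asboolP Pr|Pab]; last exact/asboolP/(cone_suppD Pab).
by apply: cone_suppD Pr _; rewrite -[X in X \in _]opprB rpredN.
Qed.

Fact cone_ord_total_order : ring_total_order cone_ord.
Proof.
split.
- by elim/quotW=> a; apply/cone_ordE; rewrite subrr; exact: cone0.
- elim/quotW=> a; elim/quotW=> b /andP[/cone_ordE Pba /cone_ordE Pab].
  apply/eqP; rewrite -(Quotient.idealrBE cone_prime_idealr).
  by apply/cone_suppP; rewrite opprB.
- elim/quotW=> a; elim/quotW=> b; elim/quotW=> c /cone_ordE Pba /cone_ordE Pac.
  by apply/cone_ordE; rewrite -(subrKA a); apply: (coneD coneP).
- elim/quotW=> a; elim/quotW=> b; apply/orP.
  case: (cone_total coneP (b - a)) => Pab; first by left; apply/cone_ordE.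
  by right; apply/cone_ordE; rewrite -opprB.
- elim/quotW=> a; elim/quotW=> b; elim/quotW=> c /cone_ordE Pab.
  rewrite -!(rmorphD (\pi_{ideal_quot cone_prime_idealr})).
  by apply/cone_ordE; rewrite opprD addrACA subrr addr0.
- elim/quotW=> a; elim/quotW=> b.
  rewrite -(rmorph0 (\pi_{ideal_quot cone_prime_idealr})).
  move=> /cone_ordE Pa /cone_ordE Pb.
  rewrite -(rmorphM (\pi_{ideal_quot cone_prime_idealr})).
  by apply/cone_ordE; rewrite !subr0 in Pa Pb *; apply: (coneM coneP).
Qed.

(** Later points of the real spectrum are built in this way: it is enough to say which elements of
    [A] are to be nonnegative, with no ordering of a quotient to define. *)
Lemma sper_of_cone : exists alpha : sper A, forall f, ge0_at f alpha <-> P f.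
Proof.
exists (Sper cone_ord_total_order) => f; rewrite /ge0_at /evalS /=.
rewrite -(rmorph0 (\pi_{ideal_quot cone_prime_idealr})).
by split=> [/cone_ordE|Pf]; [|apply/cone_ordE]; rewrite subr0.
Qed.

End PrimeCone.

Section SperCone.
Variables (A : comNzRingType) (alpha : sper A).

Let le := ord alpha.
Let leP : ring_total_order le := ordP alpha.

Lemma evalSN (f : A) : evalS (- f) alpha = - evalS f alpha.
Proof. exact: (rmorphN (\pi_{ideal_quot (supp alpha)})). Qed.

Lemma evalSD (f g : A) : evalS (f + g) alpha = evalS f alpha + evalS g alpha.
Proof. exact: (rmorphD (\pi_{ideal_quot (supp alpha)})). Qed.

Lemma evalSM (f g : A) : evalS (f * g) alpha = evalS f alpha * evalS g alpha.
Proof. exact: (rmorphM (\pi_{ideal_quot (supp alpha)})). Qed.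

Lemma le0_atN (f : A) : le0_at f alpha <-> ge0_at (- f) alpha.
Proof.
rewrite /le0_at /ge0_at evalSN -/le; split=> h.
  by have := rto_add leP (- evalS f alpha) h; rewrite subrr add0r.
by have := rto_add leP (evalS f alpha) h; rewrite add0r addNr.
Qed.

Lemma evalS_eq0 (f : A) :
  evalS f alpha = 0 <-> ge0_at f alpha /\ ge0_at (- f) alpha.
Proof.
split=> [f0|[f0 /le0_atN f0']].
  by rewrite /ge0_at evalSN f0 oppr0; split; apply: (rto_refl leP).
by apply/esym/(rto_anti leP)/andP; split.
Qed.

Lemma ge0_at_cone : prime_cone (fun f => ge0_at f alpha).
Proof.
split=> [a b|a b|a||a b].
- rewrite /ge0_at evalSD => a0 b0; apply: (rto_trans leP) b0 _.
  by have := rto_add leP (evalS b alpha) a0; rewrite add0r.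
- by rewrite /ge0_at evalSM => a0 b0; apply: (rto_mul leP).
- case/orP: (rto_total leP 0 (evalS a alpha)); first by left.
  by move=> a0; right; apply/le0_atN.
- move=> n1; have p1 : ge0_at (1 : A) alpha.
    by rewrite -[1]mulr1 -mulrNN /ge0_at evalSM; apply: (rto_mul leP).
  have /eqP := (evalS_eq0 1).2 (conj p1 n1).
  by rewrite /evalS (rmorph1 (\pi_{ideal_quot (supp alpha)})) oner_eq0.
- move=> ab nab; have := (evalS_eq0 (a * b)).2 (conj ab nab).
  rewrite evalSM => /Quotient.rquot_IdomainAxiom/orP[]/eqP/evalS_eq0; tauto.
Qed.

Lemma gt0_atP (f : A) : gt0_at f alpha <-> ~ ge0_at (- f) alpha.
Proof.
rewrite /gt0_at; split=> [[f0 nf0] nf|nf].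
  by apply: nf0; apply/evalS_eq0.
have [f0|//] := cone_total ge0_at_cone f; split=> // /evalS_eq0[]; tauto.
Qed.

Lemma evalSM_neq0 (f g : A) :
  evalS f alpha <> 0 -> evalS g alpha <> 0 -> evalS (f * g) alpha <> 0.
Proof. by rewrite evalSM => f0 g0 /Quotient.rquot_IdomainAxiom/orP[]/eqP. Qed.

End SperCone.

(** The indices are finite lists, directed by inclusion of their entries. If an object chosen for
    each list handles the entries of that list, its limit along [U] handles every element of [T]. *)
Lemma ultra_tails (T : eqType) : exists U : set_system (seq T),
  UltraFilter U /\ forall t, U [set s | t \in s].
Proof.
pose G := filter_from (setT : set (seq T)) (fun s0 => [set s : seq T | {subset s0 <= s}]).
have properG : ProperFilter G.
  apply: filter_from_proper; last by move=> s _; exists s.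
  apply: filter_from_filter; first by exists [::].
  move=> s t _ _; exists (s ++ t) => // u /= stu; split=> x xs; apply: stu.
    by rewrite mem_cat xs.
  by rewrite mem_cat xs orbT.
have [U [ultraU GU]] := ultraFilterLemma properG.
exists U; split=> // t; apply: GU.
by exists [:: t] => // s /= ts; apply: ts; rewrite mem_head.
Qed.

Lemma ultra_pick (S : Type) (U : set_system S) (T : finType) (B : T -> set S) :
  UltraFilter U -> U [set i | exists t, B t i] -> exists t, U (B t).
Proof.
move=> ultraU UB; apply: contrapT => nB.
have {}nB t : U (~` B t).
  by have [Ut|//] := in_ultra_setVsetC (B t) ultraU; case: nB; exists t.
have : U [set i | forall t, ~ B t i] by apply: filter_forall nB.
by move=> /(filterI UB)/filter_ex[i [[t Bt] /(_ t)]].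
Qed.

(** If no finite list of sets [B k] covered [T], their complements would generate a proper filter,
    and an ultrafilter above it would contain no [B k]. *)
Lemma ultra_compact (T : Type) (K : eqType) (B : K -> set T) :
  (forall U : set_system T, UltraFilter U -> exists k, U (B k)) ->
  exists s : seq K, forall x, exists2 k, k \in s & B k x.
Proof.
move=> UB; apply: contrapT => none.
pose G := filter_from (setT : set (seq K)) (fun s => [set x | forall k, k \in s -> ~ B k x]).
have properG : ProperFilter G.
  apply: filter_from_proper.
    apply: filter_from_filter; first by exists [::].
    move=> s t _ _; exists (s ++ t) => // x /= nst; split=> k ks; apply: nst.
      by rewrite mem_cat ks.
    by rewrite mem_cat ks orbT.
  move=> s _; apply: contrapT => ns; apply: none; exists s => x.
  apply: contrapT => nx; apply: ns; exists x => k ks Bk.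
  by apply: nx; exists k.
have [U [ultraU GU]] := ultraFilterLemma properG.
have [k Uk] := UB U ultraU.
have /(filterI Uk)/filter_ex[x [Bk nBk]] : U [set x | ~ B k x].
  by apply: GU; exists [:: k] => // x /=; apply; rewrite mem_head.
exact: nBk.
Qed.

Section UltraLimit.
Variables (A : comNzRingType) (I : Type) (alpha : I -> sper A).
Variables (U : set_system I) (ultraU : UltraFilter U).

(** This is the limit of the [alpha i] in the constructible topology. It is prime because, when a
    product vanishes on a set of [U], so does one of its factors. *)
Lemma ultra_sper : exists gamma : sper A,
  forall f, ge0_at f gamma <-> U [set i | ge0_at f (alpha i)].
Proof.
apply: (sper_of_cone (P := fun f => U [set i | ge0_at f (alpha i)])); split.
- move=> a b Ua Ub; apply: filterS (filterI Ua Ub) => i [].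
  exact: (coneD (ge0_at_cone _)).
- move=> a b Ua Ub; apply: filterS (filterI Ua Ub) => i [].
  exact: (coneM (ge0_at_cone _)).
- move=> a; have [Ua|Ua] := in_ultra_setVsetC [set i | ge0_at a (alpha i)] ultraU.
    by left.
  right; apply: filterS Ua => i /= na.
  by case: (cone_total (ge0_at_cone (alpha i)) a).
- by move=> /filter_ex[i /= /(coneN1 (ge0_at_cone _))].
- move=> a b Uab Unab.
  have [Ua|Ua] := in_ultra_setVsetC [set i | evalS a (alpha i) = 0] ultraU.
    by left; split; apply: filterS Ua => i /= /evalS_eq0[].
  have Ub : U [set i | evalS b (alpha i) = 0].
    apply: filterS (filterI (filterI Uab Unab) Ua) => i [[/= ab nab] na].
    have [?|?] := cone_prime (ge0_at_cone (alpha i)) ab nab; last exact/evalS_eq0.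
    by case: na; apply/evalS_eq0.
  by right; split; apply: filterS Ub => i /= /evalS_eq0[].
Qed.

End UltraLimit.

Section UltraSign.
Variables (A : comNzRingType) (S : Type) (U : set_system S) (ultraU : UltraFilter U).
Variables (alpha : S -> sper A) (lim : sper A).
Hypothesis limP : forall f, ge0_at f lim <-> U [set s | ge0_at f (alpha s)].

Lemma ultra_eq0 q : U [set s | evalS q (alpha s) = 0] -> evalS q lim = 0.
Proof.
by move=> Uq; apply/evalS_eq0; split; apply/limP; apply: filterS Uq => s /evalS_eq0[].
Qed.

Lemma ultra_gt0 q : U [set s | gt0_at q (alpha s)] -> gt0_at q lim.
Proof.
move=> Uq; apply/gt0_atP => /limP/(filterI Uq)/filter_ex[s [/gt0_atP]].
exact.
Qed.

End UltraSign.

(** * Residue fields *)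

Section OrderedField.
Variables (E : fieldType) (P : E -> Prop) (coneP : prime_cone P).

Lemma field_cone_anti x : P x -> P (- x) -> x = 0.
Proof.
move=> Px PNx; apply: contrapT => /eqP x0; apply: (coneN1 coneP).
rewrite -(mulVf x0) -mulrN; case: (cone_total coneP x^-1) => Pi.
  exact: (coneM coneP).
by rewrite mulrN -mulNr; apply: (coneM coneP).
Qed.

(** The proof of [prime_cone P] is a phantom argument: it lets the order given by [P] be attached to
    a copy of [E]. *)
Definition cone_field of prime_cone P : Type := E.
Local Notation K := (cone_field coneP).

HB.instance Definition _ := GRing.Field.on K.

Let le (x y : K) := `[< P (y - x) >].
Let lt (x y : K) := (y != x) && le x y.
Let norm (x : K) : K := if `[< P x >] then x else - x.

Let le0 (x : K) : le 0 x = `[< P x >].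
Proof. by rewrite /le subr0. Qed.
Let le0_add (x y : K) : le 0 x -> le 0 y -> le 0 (x + y).
Proof.
by rewrite !le0 => /asboolP Px /asboolP Py; apply/asboolP/(coneD coneP).
Qed.
Let le0_mul (x y : K) : le 0 x -> le 0 y -> le 0 (x * y).
Proof.
by rewrite !le0 => /asboolP Px /asboolP Py; apply/asboolP/(coneM coneP).
Qed.
Let le0_anti (x : K) : le 0 x -> le x 0 -> x = 0.
Proof.
rewrite le0 /le sub0r => /asboolP Px /asboolP PNx; exact: field_cone_anti.
Qed.
Let sub_ge0 (x y : K) : le 0 (y - x) = le x y.
Proof. by rewrite le0. Qed.
Let le0_total (x : K) : le 0 x || le x 0.
Proof.
rewrite le0 /le sub0r; apply/orP.
by case: (cone_total coneP x) => ?; [left|right]; apply/asboolP.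
Qed.
Let normN (x : K) : norm (- x) = norm x.
Proof.
rewrite /norm opprK; case: asboolP => PNx; case: asboolP => Px //.
  by rewrite (field_cone_anti Px PNx) oppr0.
by case: (cone_total coneP x).
Qed.
Let ge0_norm (x : K) : le 0 x -> norm x = x.
Proof. by rewrite le0 /norm => ->. Qed.

HB.instance Definition _ := Num.IntegralDomain_isLeReal.Build K
  le0_add le0_mul le0_anti sub_ge0 le0_total normN ge0_norm (fun _ _ => erefl).

Lemma cone_field_ge0 (x : K) : (0 <= x) <-> P x.
Proof. by change (le 0 x <-> P x); rewrite le0; split => /asboolP. Qed.

End OrderedField.

Lemma fraction_numden (R : idomainType) (u : {fraction R}) :
  exists n d : R, d != 0 /\ u = tofrac n / tofrac d.
Proof.
elim/quotW: u => x; have d0 := denom_ratioP x; exists \n_x, \d_x; split=> //.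
have d0' : tofrac \d_x != 0 by rewrite tofrac_eq0.
apply: (mulIf d0'); rewrite divfK // !piE; apply/eqmodP => /=.
rewrite /FracField.equivf /= /FracField.mulf.
rewrite !numden_Ratio ?mulf_neq0 ?oner_eq0 //.
by rewrite !mulr1 mulrC.
Qed.

Section ResidueField.
Variables (A : comNzRingType) (alpha : sper A).

Definition residue_domain : Type := {ideal_quot (supp alpha)}.
Local Notation D := residue_domain.

HB.instance Definition _ := GRing.ComNzRing.on D.

(** A domain has to come with its units and their inverses before its fraction field can be formed;
    here they are picked classically. *)
Let unitD : pred D := fun x => `[< exists y, y * x = 1 >].
Let invD (x : D) : D :=
  if pselect (exists y, y * x = 1) is left h then projT1 (cid h) else x.
Let mulVD : {in unitD, left_inverse 1 invD *%R}.
Proof.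
by move=> x /asboolP; rewrite /invD; case: pselect => // h _; case: (cid h).
Qed.
Let unitDP (x y : D) : y * x = 1 -> unitD x.
Proof. by move=> xy1; apply/asboolP; exists y. Qed.
Let invD_out : {in [predC unitD], invD =1 id}.
Proof. by move=> x /asboolPn; rewrite /invD; case: pselect. Qed.

HB.instance Definition _ :=
  GRing.ComNzRing_hasMulInverse.Build D mulVD unitDP invD_out.

Let idomD : GRing.integral_domain_axiom D.
Proof. exact: (@Quotient.rquot_IdomainAxiom A (supp alpha)). Qed.

HB.instance Definition _ := GRing.ComUnitRing_isIntegral.Build D idomD.

Definition to_residue (f : A) : {fraction D} := tofrac (evalS f alpha : D).

Lemma to_residueE f : to_residue f = tofrac (evalS f alpha : D).
Proof. by []. Qed.

Fact to_residue_zmod : zmod_morphism to_residue.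
Proof.
by move=> a b; rewrite !to_residueE -tofracB /evalS rmorphB.
Qed.

Fact to_residue_monoid : monoid_morphism to_residue.
Proof.
split; rewrite ?to_residueE /evalS ?rmorph1 //.
by move=> a b; rewrite !to_residueE evalSM tofracM.
Qed.

HB.instance Definition _ :=
  GRing.isZmodMorphism.Build A {fraction D} to_residue to_residue_zmod.
HB.instance Definition _ :=
  GRing.isMonoidMorphism.Build A {fraction D} to_residue to_residue_monoid.

Lemma to_residue_eq0 f : to_residue f = 0 <-> evalS f alpha = 0.
Proof.
rewrite to_residueE; split=> [/eqP|->]; last exact: tofrac0.
by rewrite tofrac_eq0 => /eqP.
Qed.

Lemma residue_fraction (u : {fraction D}) :
  exists a b, to_residue b != 0 /\ u = to_residue a / to_residue b.
Proof.
have [n [d [d0 ->]]] := fraction_numden u.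
exists (repr (n : {ideal_quot (supp alpha)})).
exists (repr (d : {ideal_quot (supp alpha)})).
by rewrite !to_residueE /evalS !reprK tofrac_eq0.
Qed.

End ResidueField.

Section ResidueOrder.
Variables (A : comNzRingType) (alpha : sper A).
Variables (F : fieldType) (phi : {rmorphism A -> F}).
Hypothesis phi_eq0 : forall f, phi f = 0 <-> evalS f alpha = 0.
Hypothesis phi_frac : forall u, exists a b, phi b != 0 /\ u = phi a / phi b.

(** A quotient has the sign of the product of its two terms, so the denominator may have either
    sign. *)
Definition residue_ge0 (u : F) : Prop :=
  exists a b, [/\ phi b != 0, u = phi a / phi b & ge0_at (a * b) alpha].

Let P := fun f => ge0_at f alpha.
Let coneP : prime_cone P := ge0_at_cone alpha.

Lemma cone_sqrM f g : P f -> P (f * (g * g)).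
Proof.
move=> Pf; apply: (coneM coneP) => //.
case: (cone_total coneP g) => Pg; first exact: (coneM coneP).
by rewrite -mulrNN; apply: (coneM coneP).
Qed.

Lemma cone_phi f g : phi f = phi g -> P f -> P g.
Proof.
move=> /esym/eqP; rewrite -subr_eq0 -rmorphB => /eqP/phi_eq0/evalS_eq0[Pgf _].
by move=> Pf; rewrite -(subrK f g); apply: (coneD coneP).
Qed.

Lemma cone_anti_phi f : P f -> P (- f) -> phi f = 0.
Proof. by move=> Pf PNf; apply/phi_eq0/evalS_eq0. Qed.

Lemma cone_cancel f g : phi g != 0 -> P (f * (g * g)) -> P f.
Proof.
move=> g0 Pfgg; have [//|PNf] := cone_total coneP f.
have := cone_sqrM g PNf; rewrite mulNr => /(cone_anti_phi Pfgg)/eqP.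
rewrite !rmorphM !mulf_eq0 (negPf g0) !orbF => /eqP f0.
by apply: (@cone_phi 0); rewrite ?rmorph0 ?f0 //; exact: cone0 coneP.
Qed.

Lemma residue_ge0_frac a b : phi b != 0 ->
  residue_ge0 (phi a / phi b) <-> P (a * b).
Proof.
move=> b0; split=> [[c [d [d0 /eqP e Pcd]]]|Pab]; last by exists a, b.
move: e; rewrite eqr_div // => /eqP e.
apply: (@cone_cancel _ d) => //; apply: cone_phi (cone_sqrM b Pcd).
rewrite [c * d * _]mulrACA [a * b * _]mulrACA !rmorphM e.
by rewrite [phi d * phi b]mulrC.
Qed.

Lemma residue_ge0_phi f : residue_ge0 (phi f) <-> P f.
Proof.
have phi1 : phi 1 != 0 by rewrite rmorph1 oner_eq0.
by have := residue_ge0_frac f phi1; rewrite rmorph1 divr1 mulr1.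
Qed.

Fact residue_ge0_cone : prime_cone residue_ge0.
Proof.
have anti u : residue_ge0 u -> residue_ge0 (- u) -> u = 0.
  have [a [b [b0 ->]]] := phi_frac u.
  rewrite -mulNr -rmorphN => /residue_ge0_frac Pab /residue_ge0_frac PNab.
  have := cone_anti_phi (Pab b0); rewrite -mulNr => /(_ (PNab b0))/eqP.
  by rewrite rmorphM mulf_eq0 (negPf b0) orbF => /eqP ->; rewrite mul0r.
have total u : residue_ge0 u \/ residue_ge0 (- u).
  have [a [b [b0 ->]]] := phi_frac u; rewrite -mulNr -rmorphN.
  case: (cone_total coneP (a * b)) => Pab; [left|right].
    exact: (residue_ge0_frac a b0).2.
  by apply: (residue_ge0_frac (- a) b0).2; rewrite mulNr.
split=> //.
- move=> _ _ [a [b [b0 -> Pab]]] [c [d [d0 -> Pcd]]].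
  rewrite addf_div // -!rmorphM -rmorphD; apply/residue_ge0_frac.
    by rewrite rmorphM mulf_neq0.
  rewrite mulrDl [a * d * _]mulrACA [b * d]mulrC [c * b * _]mulrACA.
  by apply: (coneD coneP); apply: cone_sqrM.
- move=> _ _ [a [b [b0 -> Pab]]] [c [d [d0 -> Pcd]]].
  rewrite mulrACA -invfM -!rmorphM; apply/residue_ge0_frac.
    by rewrite rmorphM mulf_neq0.
  by rewrite mulrACA; apply: (coneM coneP).
- move=> n1; have : (1 : F) = 0.
    apply: anti => //; rewrite -(rmorph1 phi); apply/residue_ge0_phi.
    exact: (cone1 coneP).
  by move/eqP; rewrite oner_eq0.
- move=> u v uv nuv; have /eqP := anti _ uv nuv; rewrite mulf_eq0.
  have P0 : residue_ge0 0 by case: (total 0); rewrite ?oppr0.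
  by case/orP=> /eqP->; rewrite oppr0; [left|right].
Qed.

Lemma residue_field_order : exists (K : realFieldType) (psi : {rmorphism A -> K}),
    (forall f, ge0_at f alpha <-> 0 <= psi f) /\
    (forall u, exists a b, psi b != 0 /\ u = psi a / psi b).
Proof.
exists (cone_field residue_ge0_cone), phi; split=> [f|]; last exact: phi_frac.
have [h1 h2] := iff_trans (cone_field_ge0 (coneP := residue_ge0_cone) (phi f)) (residue_ge0_phi f).
by split=> [/h2|/h1].
Qed.

End ResidueOrder.

(** The second clause keeps [K] down to the residue field of [alpha]; through it the elements of an
    ultraproduct can be lifted to families. *)
Lemma sper_field (A : comNzRingType) (alpha : sper A) :
  exists (K : realFieldType) (phi : {rmorphism A -> K}),
    (forall f, ge0_at f alpha <-> 0 <= phi f) /\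
    (forall u, exists a b, phi b != 0 /\ u = phi a / phi b).
Proof.
pose phi : {rmorphism A -> {fraction residue_domain alpha}} := @to_residue A alpha.
apply: (@residue_field_order A alpha _ phi); last exact: residue_fraction.
exact: to_residue_eq0.
Qed.

(** * Preorderings *)

Record preordering (A : comNzRingType) (T : A -> Prop) : Prop := Preordering {
  preoD : forall a b, T a -> T b -> T (a + b);
  preoM : forall a b, T a -> T b -> T (a * b);
  preo_sq : forall a, T (a * a);
  preoN1 : ~ T (-1)
}.

Lemma Zorn_above (T : Type) (Q : set T -> Prop) (S0 : set T) : Q S0 ->
  (forall F : set (set T), F !=set0 -> (forall X, F X -> Q X) ->
     total_on F subset -> Q (\bigcup_(X in F) X)) ->
  exists Y, [/\ Q Y, S0 `<=` Y & forall Z, Q Z -> Y `<=` Z -> Z `<=` Y].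
Proof.
(* Zorn's lemma is applied to the sets [X] for which [S0] united with [X] satisfies [Q]; the empty
   chain is then harmless, since its union gives back [S0]. *)
move=> QS0 Qchain; pose P := [set X : set T | Q (S0 `|` X)].
have [|X [PX maxX]] := @Zorn_bigcup T P.
  move=> F FP totF; rewrite /P /=.
  have [[X0 FX0]|F0] := pselect (F !=set0); last first.
    suff -> : \bigcup_(X in F) X = set0 by rewrite setU0.
    by apply/seteqP; split=> // x [X FX]; case: F0; exists X.
  pose G := [set S0 `|` X | X in F].
  suff -> : S0 `|` \bigcup_(X in F) X = \bigcup_(X in G) X.
    apply: Qchain => [|_ [X FX <-]|_ _ [X FX <-] [Y FY <-]].
    - by exists (S0 `|` X0); exists X0.
    - exact: FP.
    - by have [XY|YX] := totF _ _ FX FY; [left|right]; exact: setUS.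
  apply/seteqP; split=> [x [Sx|[X FX Xx]]|x [_ [X FX <-] [Sx|Xx]]].
  - by exists (S0 `|` X0); [exists X0|left].
  - by exists (S0 `|` X); [exists X|right].
  - by left.
  - by right; exists X.
exists (S0 `|` X); split; [exact: PX|by move=> x; left|].
move=> Z QZ YZ z Zz; apply: contrapT => nYz; apply: (maxX Z); last first.
  rewrite /P /=; suff -> : S0 `|` Z = Z by [].
  by apply/setUidPr => x Sx; apply: YZ; left.
split; first by move=> x Xx; apply: YZ; right.
by move=> /(_ z Zz) Xz; apply: nYz; right.
Qed.

Lemma chain_common (T : Type) (F : set (set T)) a b : total_on F subset ->
  (\bigcup_(X in F) X) a -> (\bigcup_(X in F) X) b ->
  exists X, [/\ F X, X a & X b].
Proof.
move=> totF [X FX Xa] [Y FY Yb]; have [XY|YX] := totF _ _ FX FY.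
  by exists Y; split=> //; exact: XY.
by exists X; split=> //; exact: YX.
Qed.

Section Preordering.
Variable A : comNzRingType.

Lemma preordering_maximal (T : set A) : preordering T ->
  exists Y : set A, [/\ preordering Y, T `<=` Y &
    forall Z : set A, preordering Z -> Y `<=` Z -> Z `<=` Y].
Proof.
move=> preoT; apply: Zorn_above => // F [X0 FX0] FP totF.
split=> [a b Ua Ub|a b Ua Ub|a|[X FX]]; last exact: (preoN1 (FP X FX)).
- have [X [FX Xa Xb]] := chain_common totF Ua Ub.
  by exists X => //; apply: (preoD (FP X FX)).
- have [X [FX Xa Xb]] := chain_common totF Ua Ub.
  by exists X => //; apply: (preoM (FP X FX)).
- by exists X0 => //; apply: (preo_sq (FP X0 FX0)).
Qed.

Variables (Y : set A) (preoY : preordering Y).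
Hypothesis maxY : forall Z : set A, preordering Z -> Y `<=` Z -> Z `<=` Y.

Let Y0 : Y 0. Proof. by have := preo_sq preoY 0; rewrite mulr0. Qed.
Let Y1 : Y 1. Proof. by have := preo_sq preoY 1; rewrite mulr1. Qed.

(** The set of all [p + a * q] satisfies the closure axioms of a preordering and contains [Y] and
    [a]; by maximality it can only fail by containing -1. *)
Lemma preordering_adjoin a : ~ Y a ->
  exists p q, [/\ Y p, Y q & -1 = p + a * q].
Proof.
move=> nYa; pose Z := [set x | exists p q, [/\ Y p, Y q & x = p + a * q]].
apply: contrapT => nZ; apply: nYa; apply: (maxY (Z := Z)); last first.
- by exists 0, 1; rewrite add0r mulr1.
- by move=> x Yx; exists x, 0; rewrite mulr0 addr0.
split=> // [_ _ [p [q [Yp Yq ->]]] [r [s [Yr Ys ->]]]|_ _ [p [q [Yp Yq ->]]] [r [s [Yr Ys ->]]]|x].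
- exists (p + r), (q + s); rewrite addrACA mulrDr.
  by split=> //; apply: (preoD preoY).
- exists (p * r + (a * a) * (q * s)), (p * s + q * r); split.
  + apply: (preoD preoY); first exact: (preoM preoY).
    by apply: (preoM preoY); [exact: (preo_sq preoY)|exact: (preoM preoY)].
  + by apply: (preoD preoY); apply: (preoM preoY).
  + rewrite mulrDl !mulrDr mulrACA -!addrA; congr (_ + _).
    rewrite [RHS]addrCA; congr (_ + _); first by rewrite mulrCA.
    by rewrite addrC -(mulrA a q r).
- by exists (x * x), 0; rewrite mulr0 addr0; split=> //; apply: (preo_sq preoY).
Qed.

(** Multiplying [x = - (1 + p)] by [y = - (1 + r)] gives [-1 = p + r + p * r - x * y], a sum of
    elements of [Y]. *)
Lemma preordering_contra p r x y : Y p -> Y r -> Y (- (x * y)) ->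
  -1 = p + x -> -1 = r + y -> False.
Proof.
move=> Yp Yr Yxy e1 e2; apply: (preoN1 preoY).
have e : x * y = 1 + (p + r + p * r).
  have -> : x = - (1 + p) by rewrite opprD e1 [p + x]addrC addrK.
  have -> : y = - (1 + r) by rewrite opprD e2 [r + y]addrC addrK.
  by rewrite mulrNN mulrDl !mulrDr !mul1r mulr1 -!addrA [r + _]addrCA.
have -> : -1 = p + r + p * r - x * y by rewrite e opprD addrCA subrr addr0.
by do ![apply: (preoD preoY) => //]; apply: (preoM preoY).
Qed.

(** Both totality and primality come from adjoining two elements outside [Y] and multiplying the
    identities for -1. For totality these are [a] and [- a], whose product is minus a square. For
    primality they are [a] and [b] up to sign, and [a * b] is in [Y] with either sign. *)
Lemma maximal_preordering_cone : prime_cone Y.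
Proof.
split; [exact: (preoD preoY)|exact: (preoM preoY)| |exact: (preoN1 preoY)|].
- move=> a; apply: contrapT => /not_orP[/preordering_adjoin[p [q [Yp Yq e1]]]].
  move=> /preordering_adjoin[r [s [Yr Ys e2]]].
  apply: (preordering_contra Yp Yr _ e1 e2); rewrite mulNr mulrN opprK mulrACA.
  by apply: (preoM preoY); [exact: (preo_sq preoY)|exact: (preoM preoY)].
- move=> a b Yab YNab; apply: contrapT => /not_orP[na nb].
  have sgn x : ~ (Y x /\ Y (- x)) -> exists2 x', x' = x \/ x' = - x & ~ Y x'.
    by move=> /not_andP[]; [exists x|exists (- x)]; [left| |right|].
  have [a' ea /preordering_adjoin[p [q [Yp Yq e1]]]] := sgn _ na.
  have [b' eb /preordering_adjoin[r [s [Yr Ys e2]]]] := sgn _ nb.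
  apply: (preordering_contra Yp Yr _ e1 e2); rewrite mulrACA -mulNr.
  apply: (preoM preoY); last exact: (preoM preoY).
  by case: ea => ->; case: eb => ->; rewrite ?mulNr ?mulrN ?opprK.
Qed.

End Preordering.

Lemma preordering_sper (A : comNzRingType) (T : set A) : preordering T ->
  exists alpha : sper A, forall f, T f -> ge0_at f alpha.
Proof.
move=> /preordering_maximal[Y [pY TY maxY]].
have [alpha ge0P] := sper_of_cone (maximal_preordering_cone pY maxY).
by exists alpha => f /TY /ge0P.
Qed.

(** * Real closed extensions *)

Definition order_embedding (F L : realFieldType) (f : F -> L) : Prop :=
  forall x, 0 <= x -> 0 <= f x.

Section OrderEmbedding.
Variables (F L : realFieldType) (f : {rmorphism F -> L}).
Hypothesis f_ge0 : order_embedding f.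

Lemma embedding_ge0 x : (0 <= f x) = (0 <= x).
Proof.
apply/idP/idP => [fx|]; last exact: f_ge0.
have [//|x0] := leP 0 x.
have : 0 <= f (- x) by apply: f_ge0; rewrite oppr_ge0 ltW.
rewrite rmorphN oppr_ge0 => fx'; suff : f x == 0 by rewrite fmorph_eq0 lt_eqF.
by rewrite eq_le fx fx'.
Qed.

Lemma embedding_le x y : (f x <= f y) = (x <= y).
Proof. by rewrite -subr_ge0 -rmorphB embedding_ge0 subr_ge0. Qed.

Lemma embedding_lt x y : (f x < f y) = (x < y).
Proof. by rewrite !ltNge embedding_le. Qed.

End OrderEmbedding.

Section WeightedSquares.
Variable F : realFieldType.

(** The weights are the nonnegative elements of [F], so that a point of the real spectrum of
    [{poly F}] that is nonnegative on this cone induces the given order on [F]. *)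
Inductive wsos : {poly F} -> Prop :=
| Wsos0 : wsos 0
| WsosD c s x : 0 <= c -> wsos x -> wsos (c *: (s * s) + x).

Lemma wsosD x y : wsos x -> wsos y -> wsos (x + y).
Proof.
move=> Sx Sy; elim: Sx => [|c s z c0 _ IH]; first by rewrite add0r.
by rewrite -addrA; apply: WsosD.
Qed.

Lemma wsosM x y : wsos x -> wsos y -> wsos (x * y).
Proof.
move=> Sx Sy; elim: Sx => [|c s z c0 _ IH]; first by rewrite mul0r; exact: Wsos0.
rewrite mulrDl; apply: wsosD => //.
elim: Sy => [|d t w d0 _ IHw]; first by rewrite mulr0; exact: Wsos0.
rewrite mulrDr -scalerAl -scalerAr scalerA mulrACA.
by apply: WsosD => //; apply: mulr_ge0.
Qed.

Lemma wsos_sq x : wsos (x * x).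
Proof.
rewrite -[x * x]addr0 -[x * x]scale1r.
by apply: WsosD; [exact: ler01|exact: Wsos0].
Qed.

Lemma wsosC c : 0 <= c -> wsos c%:P.
Proof.
move=> c0; have -> : c%:P = c *: (1 * 1) + 0 :> {poly F}.
  by rewrite mulr1 addr0 alg_polyC.
by apply: WsosD => //; exact: Wsos0.
Qed.

Lemma wsos_horner_ge0 (L : realFieldType) (f : {rmorphism F -> L}) x z :
  order_embedding f -> wsos x -> 0 <= (map_poly f x).[z].
Proof.
move=> f0; elim=> [|c s y c0 _ IH]; first by rewrite rmorph0 horner0.
rewrite rmorphD /= map_polyZ /= rmorphM /= hornerD hornerZ hornerM.
by rewrite addr_ge0 // mulr_ge0 ?f0 // -expr2 sqr_ge0.
Qed.

(** Each square is reduced by [s = d * p + r], and the multiple of [p] in [s * s] goes into [w]. The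
    bound is the size of [r * r]: [r] has size at most [size p - 1], hence its square at most
    [2 * (size p - 1) - 1]. *)
Lemma wsos_mod (p : {poly F}) x : (1 < size p)%N -> wsos x ->
  exists y w, [/\ wsos y, x = y + p * w & (size y <= (size p).*2 - 3)%N].
Proof.
move=> p1; elim=> [|c s _ c0 _ [y [w [Sy -> szy]]]].
  by exists 0, 0; rewrite mulr0 addr0 size_poly0; split=> //; exact: Wsos0.
have p0 : p != 0 by rewrite -size_poly_gt0 ltnW.
pose r := s %% p; pose d := s %/ p.
exists (c *: (r * r) + y), (c *: (d * (d * p + r + r)) + w); split.
- exact: WsosD.
- rewrite mulrDr addrACA; congr (_ + _).
  rewrite -scalerAr -scalerDr; congr (_ *: _).
  have -> : s = d * p + r by exact: divp_eq.
  rewrite mulrA [p * d]mulrC; set e := d * p.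
  by rewrite !mulrDl !mulrDr [r * e]mulrC [RHS]addrC !addrA.
- apply: (leq_trans (size_polyD _ _)); rewrite geq_max szy andbT.
  apply: (leq_trans (size_scale_leq _ _)).
  apply: (leq_trans (size_polyMleq _ _)).
  have : (size r < size p)%N by rewrite ltn_modp.
  by move: (size r) (size p) => m n; lia.
Qed.

End WeightedSquares.

Lemma map_horner_X (A : comNzRingType) (L : comNzRingType)
    (phi : {rmorphism {poly A} -> L}) (p : {poly A}) :
  (map_poly (phi \o polyC) p).[phi 'X] = phi p.
Proof.
elim/poly_ind: p => [|p c IH]; first by rewrite !rmorph0 horner0.
by rewrite !rmorphD !rmorphM /= map_polyX map_polyC hornerD hornerMX hornerC IH.
Qed.

(* If the cone of the weighted sums of squares modulo [p] contains -1, then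
   [1 + s = p * q] with [s] a weighted sum of squares and [q] of smaller degree.
   This [q] changes sign together with [p], so it has a root in some ordered
   extension, where [1 + s] would vanish. *)
Lemma ext_root (F : realFieldType) (p : {poly F}) u v : p.[u] * p.[v] < 0 ->
  exists (L : realFieldType) (f : {rmorphism F -> L}),
    order_embedding f /\ exists z, root (map_poly f p) z.
Proof.
have [n] := ubnP (size p); elim: n => // n IH in p u v *; rewrite ltnS => szp puv.
have p0 : p != 0 by apply: contraTneq puv => ->; rewrite horner0 mul0r ltxx.
have p1 : (1 < size p)%N.
  rewrite ltnNge; apply: contraL puv => /size1_polyC ->.
  by rewrite !hornerC -expr2 -leNgt sqr_ge0.
pose T := [set t | exists s w, wsos s /\ t = s + p * w].
have [[s [w [Ss e]]]|TN1] := pselect (T (-1)).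
  (* With the reduced sum [y], the product [p * q = 1 + y] has size at most [2 * size p - 3], which
     forces [size q <= size p - 2]: the induction applies to [q]. *)
  have [y [w' [Sy es szy]]] := wsos_mod p1 Ss.
  pose q := - (w' + w); have {}e : p * q = 1 + y.
    rewrite mulrN mulrDr; apply/eqP; rewrite eqr_oppLR opprD e es.
    by rewrite -[y + _ + _]addrA addrAC subrr add0r.
  have pq_gt0 (L : realFieldType) (f : {rmorphism F -> L}) z :
      order_embedding f -> 0 < (map_poly f p).[z] * (map_poly f q).[z].
    move=> f0; rewrite -hornerM -rmorphM e rmorphD rmorph1 hornerD hornerC.
    exact: ltr_pwDl ltr01 (wsos_horner_ge0 z f0 Sy).
  have quv : q.[u] * q.[v] < 0.
    have := pq_gt0 F idfun u (fun _ => id); have := pq_gt0 F idfun v (fun _ => id).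
    rewrite !map_poly_id // => pqv pqu; rewrite ltNge; apply/negP => quv.
    have := mulr_gt0 pqu pqv; rewrite mulrACA ltNge => /negP; apply.
    by rewrite mulr_le0_ge0 // ltW.
  have q0 : q != 0 by apply: contraTneq quv => ->; rewrite horner0 mul0r ltxx.
  have szq : (size q < n)%N.
    apply: leq_trans szp; have : (size (p * q)%R <= (size p).*2 - 3)%N.
      rewrite e (leq_trans (size_polyD _ _)) // geq_max szy size_poly1 andbT.
      by move: (size p) p1 => m; lia.
    by rewrite size_mul //; move: (size p) (size q) p1 => m k; lia.
  have [L [f [f0 [z /rootP qz]]]] := IH q u v szq quv.
  by have := pq_gt0 L f z f0; rewrite qz mulr0 ltxx.
have preT : preordering T.
  split=> //.
  - move=> _ _ [s [w [Ss ->]]] [t [w' [St ->]]]; exists (s + t), (w + w').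
    by rewrite addrACA mulrDr; split=> //; exact: wsosD.
  - move=> _ _ [s [w [Ss ->]]] [t [w' [St ->]]].
    exists (s * t), (s * w' + w * (t + p * w')); split; first exact: wsosM.
    rewrite mulrDl mulrDr [p * (_ + _)]mulrDr -addrA; congr (_ + _).
    by rewrite mulrCA -(mulrA p w).
  - by move=> a; exists (a * a), 0; rewrite mulr0 addr0; split=> //; exact: wsos_sq.
have [alpha Talpha] := preordering_sper preT.
have [L [phi [phiP _]]] := sper_field alpha.
exists L, (phi \o polyC); split=> [c c0|].
  apply/phiP/Talpha; exists c%:P, 0; rewrite mulr0 addr0; split=> //.
  exact: wsosC.
(* Both [p] and [- p] are in [T], so [p] vanishes at [alpha] and the class of ['X] is a root. *)
exists (phi 'X); apply/rootP; rewrite map_horner_X; apply/eqP; rewrite eq_le.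
rewrite -oppr_ge0 -rmorphN; apply/andP; split; apply/phiP/Talpha.
  by exists 0, (- 1); rewrite mulrN1 add0r; split=> //; exact: Wsos0.
by exists 0, 1; rewrite mulr1 add0r; split=> //; exact: Wsos0.
Qed.

(** Denominators are cleared so that a fraction can be substituted in [p] while staying among
    polynomials. The exponent [size p] is one more than the degree, and costs only a further factor
    [D]. *)
Lemma horner_subst_frac (F : fieldType) (p N D : {poly F}) z : D.[z] != 0 ->
  (\sum_(i < size p) p`_i *: (N ^+ i * D ^+ (size p - i))).[z] =
  D.[z] ^+ size p * p.[N.[z] / D.[z]].
Proof.
move=> D0; rewrite horner_sum [p.[_]]horner_coef mulr_sumr; apply: eq_bigr => i _.
rewrite hornerZ hornerM !horner_exp expr_div_n [RHS]mulrCA; congr (_ * _).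
rewrite [RHS]mulrCA; congr (_ * _); apply: (mulIf (expf_neq0 i D0)).
by rewrite -exprD subnK ?divfK ?expf_neq0 // ltnW.
Qed.

Lemma ext_ivt (F : realFieldType) (p : {poly F}) a b :
  a <= b -> p.[a] <= 0 <= p.[b] ->
  exists (L : realFieldType) (f : {rmorphism F -> L}),
    order_embedding f /\ exists2 z, f a <= z <= f b & root (map_poly f p) z.
Proof.
move=> ab /andP[pa pb].
have [pa0|pa0] := eqVneq p.[a] 0.
  exists F, idfun; split=> //; exists a; first by rewrite lexx.
  by rewrite map_poly_id //; apply/rootP.
have [pb0|pb0] := eqVneq p.[b] 0.
  exists F, idfun; split=> //; exists b; first by rewrite lexx andbT.
  by rewrite map_poly_id //; apply/rootP.
(* [4 Z^2 / (1 + Z^2)^2] maps any ordered field into [0, 1] and attains both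
   bounds, so a root of the substituted polynomial automatically gives a root of
   [p] between [a] and [b] *)
pose D : {poly F} := (1 + 'X ^+ 2) ^+ 2.
pose N : {poly F} := a%:P * D + (b - a)%:P * ('X *+ 2) ^+ 2.
pose q := \sum_(i < size p) p`_i *: (N ^+ i * D ^+ (size p - i)).
have hD (L : realFieldType) (f : {rmorphism F -> L}) z :
    (map_poly f D).[z] = (1 + z ^+ 2) ^+ 2.
  by rewrite /D rmorphXn /= rmorphD rmorph1 /= map_polyXn !hornerE.
have D_gt0 (L : realFieldType) (z : L) : 0 < (1 + z ^+ 2) ^+ 2.
  by rewrite exprn_gt0 // ltr_pwDl // sqr_ge0.
have hN (L : realFieldType) (f : {rmorphism F -> L}) z :
    (map_poly f N).[z] = f a * (1 + z ^+ 2) ^+ 2 + (f b - f a) * (z *+ 2) ^+ 2.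
  rewrite /N -(hD L f z); generalize D => E.
  rewrite rmorphD (rmorphM _ _ E) (rmorphM _ _ (_ ^+ 2)) rmorphXn rmorphMn /=.
  rewrite map_polyX !map_polyC /= rmorphB.
  by rewrite hornerD !hornerM !hornerC hornerMn hornerX.
have hq (L : realFieldType) (f : {rmorphism F -> L}) z : (map_poly f q).[z] =
    (map_poly f D).[z] ^+ size p *
    (map_poly f p).[(map_poly f N).[z] / (map_poly f D).[z]].
  rewrite -(size_map_poly f p) -horner_subst_frac ?hD ?(gt_eqF (D_gt0 _ _)) //.
  congr _.[_]; rewrite rmorph_sum size_map_poly /=; apply: eq_bigr => i _.
  by rewrite map_polyZ rmorphM !rmorphXn coef_map.
have quv : q.[0] * q.[1] < 0.
  have hq' z : q.[z] = D.[z] ^+ size p * p.[N.[z] / D.[z]].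
    by have := hq F idfun z; rewrite !map_poly_id.
  have D' z : D.[z] = (1 + z ^+ 2) ^+ 2.
    by have := hD F idfun z; rewrite !map_poly_id.
  have N' z : N.[z] = a * (1 + z ^+ 2) ^+ 2 + (b - a) * (z *+ 2) ^+ 2.
    by have := hN F idfun z; rewrite !map_poly_id.
  rewrite !hq' mulrACA pmulr_rlt0; last by rewrite mulr_gt0 ?exprn_gt0 // D'.
  have -> : N.[0] / D.[0] = a.
    by rewrite N' D' mul0rn expr0n /= addr0 expr1n mulr1 mulr0 addr0 divr1.
  have -> : N.[1] / D.[1] = b.
    by rewrite N' D' expr1n -mulrDl addrC subrK mulfK // expf_neq0 // pnatr_eq0.
  by rewrite nmulr_rlt0 lt_neqAle ?pa0 // eq_sym pb0.
have [L [f [f0 [z /rootP]]]] := ext_root quv.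
rewrite hq => /eqP; rewrite mulf_eq0 expf_eq0 hD (gt_eqF (D_gt0 _ _)) andbF /= => pz.
exists L, f; split=> //; exists ((map_poly f N).[z] / (map_poly f D).[z]); last first.
  by rewrite hD.
have fab : f a <= f b by rewrite embedding_le.
rewrite hN hD ler_pdivlMr ?D_gt0 // ler_pdivrMr ?D_gt0 //.
have h : (z *+ 2) ^+ 2 <= (1 + z ^+ 2) ^+ 2.
  by have := sqr_ge0 (1 - z ^+ 2); rewrite -mulr_natl; nra.
have h0 : 0 <= (z *+ 2) ^+ 2 by exact: sqr_ge0.
have fba : 0 <= f b - f a by rewrite subr_ge0.
rewrite lerDl mulr_ge0 //= -lerBrDl -mulrBl.
exact: ler_wpM2l.
Qed.

(* [(p, a, b)] asks for a root of [p] in the interval [[a, b]]. *)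
Definition root_task (F : realFieldType) : Type := ({poly F} * F * F)%type.

Definition solves (F L : realFieldType) (f : {rmorphism F -> L})
    (t : root_task F) : Prop :=
  t.1.2 <= t.2 -> t.1.1.[t.1.2] <= 0 <= t.1.1.[t.2] ->
  exists2 z, f t.1.2 <= z <= f t.2 & root (map_poly f t.1.1) z.

Lemma ext_solves_seq (F : realFieldType) (s : seq (root_task F)) :
  exists (L : realFieldType) (f : {rmorphism F -> L}),
    order_embedding f /\ forall t, t \in s -> solves f t.
Proof.
elim: s => [|[[p a] b] s [L [f [f0 IH]]]]; first by exists F, idfun; split.
have [h|nh] := pselect (a <= b /\ p.[a] <= 0 <= p.[b]); last first.
  exists L, f; split=> // t; rewrite inE => /predU1P[->|/IH//].
  by move=> /= ab pab; case: nh.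
case: h => ab pab.
have fab : f a <= f b by rewrite embedding_le.
have pfab : (map_poly f p).[f a] <= 0 <= (map_poly f p).[f b].
  by rewrite !horner_map -(rmorph0 f) !embedding_le.
have [M [g [g0 [z zab pz]]]] := ext_ivt fab pfab.
exists M, (g \o f); split=> [x x0|t]; first by apply/g0/f0.
rewrite inE => /predU1P[->|/IH ft] /=.
  by move=> _ _; exists z; rewrite // map_poly_comp.
move=> tab tpab; have [w wab pw] := ft tab tpab.
exists (g w); first by rewrite /= !embedding_le.
by rewrite map_poly_comp; apply/rootP; rewrite horner_map (rootP pw) rmorph0.
Qed.

Section DependentProduct.
Variables (I : Type) (i0 : I) (L : I -> comNzRingType).

(** The phantom index witnesses that there is at least one factor, as a ring with [1 != 0]
    requires. *)
Definition dprod of I : Type := forall i, L i.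
Local Notation T := (dprod i0).

HB.instance Definition _ := gen_eqMixin T.
HB.instance Definition _ := gen_choiceMixin T.

Let addA : associative (fun f g : T => (fun i => f i + g i) : T).
Proof. by move=> f g h; apply: functional_extensionality_dep => i; rewrite addrA. Qed.
Let addC : commutative (fun f g : T => (fun i => f i + g i) : T).
Proof. by move=> f g; apply: functional_extensionality_dep => i; rewrite addrC. Qed.
Let add0 : left_id ((fun i => 0) : T) (fun f g : T => (fun i => f i + g i) : T).
Proof. by move=> f; apply: functional_extensionality_dep => i; rewrite add0r. Qed.
Let addN : left_inverse ((fun i => 0) : T) (fun f : T => (fun i => - f i) : T)
  (fun f g : T => (fun i => f i + g i) : T).
Proof. by move=> f; apply: functional_extensionality_dep => i; rewrite addNr. Qed.

HB.instance Definition _ := GRing.isZmodule.Build T addA addC add0 addN.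

Let mulA : associative (fun f g : T => (fun i => f i * g i) : T).
Proof. by move=> f g h; apply: functional_extensionality_dep => i; rewrite mulrA. Qed.
Let mulC : commutative (fun f g : T => (fun i => f i * g i) : T).
Proof. by move=> f g; apply: functional_extensionality_dep => i; rewrite mulrC. Qed.
Let mul1 : left_id ((fun i => 1) : T) (fun f g : T => (fun i => f i * g i) : T).
Proof. by move=> f; apply: functional_extensionality_dep => i; rewrite mul1r. Qed.
Let mulDl : left_distributive (fun f g : T => (fun i => f i * g i) : T) +%R.
Proof. by move=> f g h; apply: functional_extensionality_dep => i; rewrite mulrDl. Qed.
Let one_neq0 : ((fun i => 1) : T) != 0.
Proof. by apply/eqP => /(congr1 (fun f : T => f i0))/eqP; rewrite oner_eq0. Qed.

HB.instance Definition _ :=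
  GRing.Zmodule_isComNzRing.Build T mulA mulC mul1 mulDl one_neq0.

Definition dproj (i : I) (f : T) : L i := f i.

Fact dproj_zmod i : zmod_morphism (dproj i). Proof. by []. Qed.
Fact dproj_monoid i : monoid_morphism (dproj i). Proof. by []. Qed.
HB.instance Definition _ i := GRing.isZmodMorphism.Build T (L i) (dproj i) (dproj_zmod i).
HB.instance Definition _ i := GRing.isMonoidMorphism.Build T (L i) (dproj i) (dproj_monoid i).

Variables (F : comNzRingType) (f : forall i, {rmorphism F -> L i}).

Definition dtuple (x : F) : T := fun i => f i x.

Fact dtuple_zmod : zmod_morphism dtuple.
Proof. by move=> x y; apply: functional_extensionality_dep => i; apply: rmorphB. Qed.
Fact dtuple_monoid : monoid_morphism dtuple.
Proof.
split=> [|x y]; apply: functional_extensionality_dep => i; [exact: rmorph1|exact: rmorphM].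
Qed.
HB.instance Definition _ := GRing.isZmodMorphism.Build F T dtuple dtuple_zmod.
HB.instance Definition _ := GRing.isMonoidMorphism.Build F T dtuple dtuple_monoid.

End DependentProduct.

Lemma pullback_sper (B : comNzRingType) (L : realFieldType) (psi : {rmorphism B -> L}) :
  exists alpha : sper B, forall b, ge0_at b alpha <-> 0 <= psi b.
Proof.
apply: sper_of_cone; split=> [a b|a b|a||a b].
- by rewrite rmorphD; exact: addr_ge0.
- by rewrite rmorphM; exact: mulr_ge0.
- by rewrite rmorphN oppr_ge0; apply/orP; exact: le_total.
- by rewrite rmorphN rmorph1 oppr_ge0 lt_geF // ltr01.
- rewrite !rmorphN oppr_ge0 rmorphM => h1 h2.
  have : psi a * psi b == 0 by rewrite eq_le h1 h2.
  by rewrite mulf_eq0 => /orP[]/eqP->; [left|right]; rewrite oppr0 lexx.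
Qed.

Section UltraField.
Variables (B : comNzRingType) (I : Type) (L : I -> realFieldType).
Variables (psi : forall i, {rmorphism B -> L i}).
Variables (U : set_system I) (ultraU : UltraFilter U).

(** The ultraproduct is obtained as the residue field of a limit point. The ring [B] need not be the
    full product: for the tower it is the subring of eventually coherent sequences. *)
Lemma ultra_field : exists (K : realFieldType) (phi : {rmorphism B -> K}),
  [/\ forall b, U [set i | 0 <= psi i b] -> 0 <= phi b,
      forall b, 0 <= phi b -> U [set i | 0 <= psi i b],
      forall b, U [set i | psi i b = 0] -> phi b = 0 &
      forall u, exists a b, phi b != 0 /\ u = phi a / phi b].
Proof.
have [alpha alphaP] := choice (fun i => pullback_sper (psi i)).
have [gamma gammaP] := ultra_sper alpha ultraU.
have eqU b : [set i | ge0_at b (alpha i)] = [set i | 0 <= psi i b].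
  by apply/seteqP; split=> i /alphaP.
have [K [phi [phiP phi_frac]]] := sper_field gamma.
have ge0 b : U [set i | 0 <= psi i b] -> 0 <= phi b.
  by rewrite -eqU => /gammaP /phiP.
exists K, phi; split=> // b; first by move=> /phiP /gammaP; rewrite eqU.
move=> Ub; apply/eqP; rewrite eq_le -oppr_ge0 -rmorphN.
by apply/andP; split; apply: ge0; apply: filterS Ub => i /=; rewrite ?rmorphN => ->;
  rewrite ?oppr0.
Qed.

End UltraField.

(** The ultraproduct over all finite lists of tasks solves every task at once, since almost every
    list contains a given one. *)
Lemma ext_solves (F : realFieldType) :
  exists (L : realFieldType) (f : {rmorphism F -> L}),
    order_embedding f /\ forall t, solves f t.
Proof.
pose I := seq (root_task F).
have cL (s : I) := cid (ext_solves_seq s).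
have cf (s : I) := cid (projT2 (cL s)).
pose L s := projT1 (cL s); pose f s : {rmorphism F -> L s} := projT1 (cf s).
have fP s : order_embedding (f s) /\ forall t, t \in s -> solves (f s) t.
  exact: projT2 (cf s).
pose B : comNzRingType := @dprod I L [::].
pose psi (s : I) : {rmorphism B -> L s} := @dproj I [::] L s.
pose diag : {rmorphism F -> B} := @dtuple I [::] L F f.
have [U [ultraU tails]] := ultra_tails (root_task F).
have [K [phi [phi_ge0 _ phi_eq0 _]]] := ultra_field psi ultraU.
exists K, (phi \o diag); split=> [x x0|[[p a] b] /= ab pab].
  by apply: phi_ge0; apply: filterS filterT => s _; apply: (fP s).1.
pose t : root_task F := (p, a, b).
have Ut := tails t.
(* Lists without the task receive the value 0; they form a set outside [U]. *)
have root_at s : exists z, t \in s -> f s a <= z <= f s b /\ root (map_poly (f s) p) z.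
  have [ts|] := boolP (t \in s); last by exists 0.
  by have [z zab pz] := (fP s).2 t ts ab pab; exists z.
pose z : B := fun s => projT1 (cid (root_at s)).
have zP s : t \in s -> f s a <= z s <= f s b /\ root (map_poly (f s) p) (z s).
  exact: projT2 (cid (root_at s)).
exists (phi z).
  rewrite /= -(subr_ge0 (phi (diag a))) -(subr_ge0 (phi z)) -!rmorphB.
  by apply/andP; split; apply: phi_ge0; apply: filterS Ut => s /= /zP[/andP[za zb] _];
    rewrite subr_ge0.
apply/rootP; rewrite map_poly_comp horner_map; apply: phi_eq0.
apply: filterS Ut => s /= /zP[_ /rootP <-].
by rewrite -(horner_map (psi s)) -map_poly_comp.
Qed.

(** The induction on [N] shifts the whole family of types, which avoids casts between stages; [d]
    fills the entries before [N]. *)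
Lemma extend_sequence (T : nat -> Type) (d : forall n, T n)
    (m : forall n, T n -> T n.+1) N (x : T N) :
  exists s : forall n, T n, s N = x /\ forall n, (N <= n)%N -> s n.+1 = m n (s n).
Proof.
elim: N T d m x => [|N IH] T d m x; first by exists (nat_rect T x m).
have [s [sN sm]] := IH (fun n => T n.+1) (fun n => d n.+1) (fun n => m n.+1) x.
exists (fun n => if n is n'.+1 return T n then s n' else d 0%N); split=> //.
by case=> // n; exact: sm.
Qed.

Section Tower.
Variables (T : nat -> realFieldType) (m : forall n, {rmorphism T n -> T n.+1}).
Hypothesis m_ge0 : forall n, order_embedding (m n).

Local Notation P := (@dprod nat T 0%N).

(** Sequences that eventually follow the maps [m] stand for the elements of the direct limit; their
    first entries are arbitrary. *)
Definition coherent_from (N : nat) (s : P) :=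
  forall n, (N <= n)%N -> s n.+1 = m n (s n).

Definition coherent : pred P := fun s => `[< exists N, coherent_from N s >].

Lemma coherentP s : reflect (exists N, coherent_from N s) (s \in coherent).
Proof. exact: asboolP. Qed.

Lemma coherent2 (op : forall n, T n -> T n -> T n) :
  (forall n x y, m n (op n x y) = op n.+1 (m n x) (m n y)) ->
  forall s t, s \in coherent -> t \in coherent ->
    ((fun n => op n (s n) (t n)) : P) \in coherent.
Proof.
move=> mop s t /coherentP[N sN] /coherentP[M tM]; apply/coherentP.
exists (maxn N M) => n; rewrite geq_max => /andP[Nn Mn].
by rewrite sN // tM // mop.
Qed.

Fact coherent_subring : subring_closed coherent.
Proof.
split; first by apply/coherentP; exists 0%N => n _; rewrite /= rmorph1.
  by apply: (coherent2 (op := fun n x y => x - y)) => n x y; rewrite rmorphB.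
by apply: (coherent2 (op := fun n x y => x * y)) => n x y; rewrite rmorphM.
Qed.

HB.instance Definition _ := GRing.isSubringClosed.Build P coherent coherent_subring.

Record tower_seq := TowerSeq { tower_val :> P; _ : tower_val \in coherent }.
HB.instance Definition _ := [isSub for tower_val].
HB.instance Definition _ := [Choice of tower_seq by <:].
HB.instance Definition _ := [SubChoice_isSubComNzRing of tower_seq by <:].

Definition tower_at n : tower_seq -> T n := fun s => tower_val s n.
Fact tower_at_zmod n : zmod_morphism (tower_at n). Proof. by []. Qed.
Fact tower_at_monoid n : monoid_morphism (tower_at n). Proof. by []. Qed.
HB.instance Definition _ n :=
  GRing.isZmodMorphism.Build tower_seq (T n) (tower_at n) (tower_at_zmod n).
HB.instance Definition _ n :=
  GRing.isMonoidMorphism.Build tower_seq (T n) (tower_at n) (tower_at_monoid n).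

Lemma coherent_poly (p : {poly tower_seq}) : exists N, forall n, (N <= n)%N ->
  map_poly (m n) (map_poly (tower_at n) p) = map_poly (tower_at n.+1) p.
Proof.
elim/poly_ind: p => [|p c [N IH]]; first by exists 0%N => n _; rewrite !rmorph0.
have /coherentP[M cM] : tower_val c \in coherent by exact: valP.
exists (maxn N M) => n; rewrite geq_max => /andP[Nn Mn].
rewrite !(rmorphD, rmorphM) /= !map_polyX !map_polyC /= IH //; congr (_ + _%:P).
by rewrite /tower_at cM.
Qed.

Lemma coherent_extend N (x : T N) :
  exists2 s : tower_seq, tower_at N s = x & coherent_from N (tower_val s).
Proof.
have [s [sN cs]] := extend_sequence (fun n => 0) (fun n => m n) x.
have cs' : (s : P) \in coherent by apply/coherentP; exists N.
by exists (TowerSeq cs').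
Qed.

Fixpoint tower_from0 n : {rmorphism T 0%N -> T n} :=
  if n is n'.+1 then (m n' \o tower_from0 n' : {rmorphism T 0%N -> T n'.+1})
  else idfun.

Lemma tower_from0_ge0 n : order_embedding (tower_from0 n).
Proof. by elim: n => //= n IH x x0; apply/m_ge0/IH. Qed.

Fact tower_diag_coherent x : @dtuple nat 0%N T _ tower_from0 x \in coherent.
Proof. by apply/coherentP; exists 0%N. Qed.

Definition tower_diag x : tower_seq := TowerSeq (tower_diag_coherent x).

Fact tower_diag_zmod : zmod_morphism tower_diag.
Proof. by move=> x y; apply: val_inj; apply: (rmorphB (@dtuple nat 0%N T _ tower_from0)). Qed.
Fact tower_diag_monoid : monoid_morphism tower_diag.
Proof.
split=> [|x y]; apply: val_inj; first exact: (rmorph1 (@dtuple nat 0%N T _ tower_from0)).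
exact: (rmorphM (@dtuple nat 0%N T _ tower_from0)).
Qed.
HB.instance Definition _ :=
  GRing.isZmodMorphism.Build (T 0%N) tower_seq tower_diag tower_diag_zmod.
HB.instance Definition _ :=
  GRing.isMonoidMorphism.Build (T 0%N) tower_seq tower_diag tower_diag_monoid.

Fact tower_inv_coherent (s : tower_seq) : ((fun n => (tower_at n s)^-1) : P) \in coherent.
Proof.
have /coherentP[N cN] : tower_val s \in coherent by exact: valP.
by apply/coherentP; exists N => n Nn; rewrite /tower_at cN // fmorphV.
Qed.

Definition tower_inv s := TowerSeq (tower_inv_coherent s).

Hypothesis m_solves : forall n t, solves (m n) t.

Lemma tower_real_closed : exists (K : rcfType) (f : {rmorphism T 0%N -> K}),
  order_embedding f.
Proof.
have [U [ultraU UN]] := ultraFilterLemma eventually_filter.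
have Uge N : U [set n | (N <= n)%N] by apply: UN; exists N.
have [K [phi [phi_ge0 phi_ge0' phi_eq0 phi_frac]]] := ultra_field tower_at ultraU.
(* A denominator with nonzero image is nonzero on a set of [U], so its pointwise inverse represents
   the inverse. *)
have phi_surj u : exists s, u = phi s.
  have [a [b [b0 ->]]] := phi_frac u; exists (a * tower_inv b).
  rewrite rmorphM; congr (_ * _); apply: (mulfI b0); rewrite divff // -rmorphM.
  apply/esym/eqP; rewrite -subr_eq0 -(rmorph1 phi) -rmorphB; apply/eqP/phi_eq0.
  have [Ub|Ub] := in_ultra_setVsetC [set n | tower_at n b = 0] ultraU.
    by rewrite (phi_eq0 _ Ub) eqxx in b0.
  apply: filterS Ub => n /eqP bn0.
  change (tower_at n b / tower_at n b - 1 = 0).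
  by rewrite divff // subrr.
have phi_le a b : phi a <= phi b -> U [set n | tower_at n a <= tower_at n b].
  rewrite -subr_ge0 -rmorphB => /phi_ge0'; apply: filterS => n.
  by change (0 <= tower_at n b - tower_at n a -> tower_at n a <= tower_at n b); rewrite subr_ge0.
have le_phi a b : U [set n | tower_at n a <= tower_at n b] -> phi a <= phi b.
  move=> Uab; rewrite -subr_ge0 -rmorphB; apply: phi_ge0; apply: filterS Uab => n abn.
  by change (0 <= tower_at n b - tower_at n a); rewrite subr_ge0.
have closedK : Num.real_closed_axiom K.
  move=> p u v; have [a ->] := phi_surj u; have [b ->] := phi_surj v.
  have [c cP] := choice phi_surj.
  pose q := \poly_(i < size p) c p`_i.
  have -> : p = map_poly phi q.
    apply/polyP => i; rewrite coef_map coef_poly; case: ltnP => [_|szp] /=.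
      exact: cP.
    by rewrite rmorph0 nth_default.
  rewrite !horner_map -(rmorph0 phi) => ab /andP[qa qb].
  have [N1 qN1] := coherent_poly q.
  have /coherentP[N2 aN2] : tower_val a \in coherent by exact: valP.
  have /coherentP[N3 bN3] : tower_val b \in coherent by exact: valP.
  have UI V W : U V -> U W -> U (V `&` W) by exact: filterI.
  have /filter_ex[n [[abn [qan qbn]] [n1 [n2 n3]]]] := UI _ _
    (UI _ _ (phi_le _ _ ab) (UI _ _ (phi_le _ _ qa) (phi_le _ _ qb)))
    (UI _ _ (Uge N1) (UI _ _ (Uge N2) (Uge N3))).
  have {}qan : (map_poly (tower_at n) q).[tower_at n a] <= 0 by rewrite horner_map.
  have {}qbn : 0 <= (map_poly (tower_at n) q).[tower_at n b] by rewrite horner_map.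
  (* At a stage [n] past all thresholds the sign change is visible. The root appears in [T n.+1] and
     is then carried along the tower, so that it is coherent from [n.+1] on. *)
  have [|z zab qz] := @m_solves n (map_poly (tower_at n) q, tower_at n a, tower_at n b) abn.
    by rewrite /= qan.
  have [s sz cs] := coherent_extend z.
  have sP k : (n < k)%N -> tower_at k a <= tower_at k s <= tower_at k b /\
      root (map_poly (tower_at k) q) (tower_at k s).
    elim: k => // k IH; rewrite ltnS leq_eqVlt => /predU1P[<-|nk].
      by rewrite sz /tower_at aN2 // bN3 // -qN1.
    have [kab qk] := IH nk; have le_n := leq_trans _ (ltnW nk).
    rewrite -qN1 ?le_n // /tower_at aN2 ?le_n // bN3 ?le_n // cs //.
    split; first by rewrite !embedding_le.
    by apply/rootP; rewrite horner_map (rootP qk) rmorph0.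
  exists (phi s).
    by apply/andP; split; apply: le_phi; apply: filterS (Uge n.+1) => k /= /sP[/andP[]].
  apply/rootP; rewrite horner_map; apply: phi_eq0.
  by apply: filterS (Uge n.+1) => k /= /sP[_ /rootP]; rewrite horner_map.
pose KC := Num.RealField_isClosed.Build K closedK.
pose K' : rcfType := HB.pack K KC.
exists K', (phi \o tower_diag : {rmorphism T 0%N -> K'}) => x x0.
by apply: phi_ge0; apply: filterS filterT => n _; exact: tower_from0_ge0.
Qed.

End Tower.

(** Stage [n.+1] contains the roots requested by polynomials and intervals of stage [n], and every
    request over the limit already occurs at some stage. *)
Theorem real_closed_extension (F : realFieldType) :
  exists (K : rcfType) (f : {rmorphism F -> K}), order_embedding f.
Proof.
have cL (L : realFieldType) := cid (ext_solves L).
have cf (L : realFieldType) := cid (projT2 (cL L)).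
pose T := fix T n : realFieldType := if n is n'.+1 then projT1 (cL (T n')) else F.
pose m n : {rmorphism T n -> T n.+1} := projT1 (cf (T n)).
have mP n : order_embedding (m n) /\ forall t, solves (m n) t.
  exact: projT2 (cf (T n)).
exact: (@tower_real_closed T m (fun n => (mP n).1) (fun n => (mP n).2)).
Qed.

(** * Quantifier elimination and transfer *)

Section QeNaturality.
Import qe_rcf.
Local Open Scope qf_scope.
Variables (R K : realFieldType) (emb : {rmorphism R -> K}).

Fixpoint term_map (t : term R) : term K :=
  match t with
  | Var i => Var K i
  | Const x => Const (emb x)
  | NatConst n => NatConst K n
  | Add u v => Add (term_map u) (term_map v)
  | Opp u => Opp (term_map u)
  | NatMul u n => NatMul (term_map u) n
  | Mul u v => Mul (term_map u) (term_map v)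
  | Exp u n => Exp (term_map u) n
  end.

Fixpoint formula_map (f : formula R) : formula K :=
  match f with
  | Bool b => Bool b
  | Equal u v => Equal (term_map u) (term_map v)
  | Lt u v => Lt (term_map u) (term_map v)
  | Le u v => Le (term_map u) (term_map v)
  | And f g => And (formula_map f) (formula_map g)
  | Or f g => Or (formula_map f) (formula_map g)
  | Implies f g => Implies (formula_map f) (formula_map g)
  | Not f => Not (formula_map f)
  end.

Local Notation fm := formula_map.
Local Notation tm := term_map.
Local Notation pm := (map term_map).

(** The elimination procedure is written in continuation-passing style on terms and treats constants
    formally, so it commutes with applying [emb] to the constants. This is checked for one
    subroutine after the other, assuming it for the continuation. *)
Lemma map_Size p k k' : (forall n, fm (k n) = k' n) -> fm (Size p k) = Size (pm p) k'.
Proof.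
elim: p k k' => [|c p IH] k k' kk' /=; first exact: kk'.
by apply: IH => -[|n] /=; rewrite !kk' ?rmorph0.
Qed.

Lemma map_Isnull p k k' : (forall b, fm (k b) = k' b) -> fm (Isnull p k) = Isnull (pm p) k'.
Proof. by move=> kk'; apply: map_Size. Qed.

Lemma map_LtSize p q k k' : (forall b, fm (k b) = k' b) ->
  fm (LtSize p q k) = LtSize (pm p) (pm q) k'.
Proof. by move=> kk'; do 2![apply: map_Size => ?]; apply: kk'. Qed.

Lemma map_LeadCoef p k k' : (forall t, fm (k t) = k' (tm t)) ->
  fm (LeadCoef p k) = LeadCoef (pm p) k'.
Proof.
elim: p k k' => [|c p IH] k k' kk' /=; first by rewrite kk' /= rmorph0.
by apply: IH => t /=; rewrite !kk'.
Qed.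

Lemma map_AmulXn a n : pm (AmulXn a n) = AmulXn (tm a) n.
Proof. by elim: n => //= n ->; rewrite rmorph0. Qed.

Lemma map_AddPoly p q : pm (AddPoly p q) = AddPoly (pm p) (pm q).
Proof. by elim: p q => [|a p IH] [|b q] //=; rewrite IH. Qed.

Lemma map_ScalPoly c p : pm (ScalPoly c p) = ScalPoly (tm c) (pm p).
Proof. by rewrite /ScalPoly -!map_comp. Qed.

Lemma map_MulPoly p q : pm (MulPoly p q) = MulPoly (pm p) (pm q).
Proof. by elim: p => //= a p IH; rewrite map_AddPoly map_ScalPoly /= IH. Qed.

Lemma map_ExpPoly p n : pm (ExpPoly p n) = ExpPoly (pm p) n.
Proof.
case: n => // n; rewrite /ExpPoly !iteropS; elim: n => //= n IH.
by rewrite map_MulPoly IH.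
Qed.

Lemma map_OppPoly p : pm (OppPoly p) = OppPoly (pm p).
Proof. by rewrite /OppPoly map_ScalPoly /= rmorphN rmorph1. Qed.

Lemma map_Deriv p : pm (Deriv p) = Deriv (pm p).
Proof. by elim: p => //= a p IH; rewrite map_AddPoly /= IH. Qed.

Lemma map_Rediv_rec_loop q sq cq c qq r n k k' :
  (forall c qq r, fm (k (c, qq, r)) = k' (c, pm qq, pm r)) ->
  fm (Rediv_rec_loop q sq cq c qq r n k) =
  Rediv_rec_loop (pm q) sq (tm cq) c (pm qq) (pm r) n k'.
Proof.
move=> kk'; elim: n c qq r => [|n IH] c qq r /=; apply: map_Size => m /=;
  case: ifP => // _; apply: map_LeadCoef => l /=.
  by rewrite kk' !map_AddPoly !map_MulPoly map_OppPoly map_MulPoly map_AmulXn.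
by rewrite IH !map_AddPoly !map_MulPoly map_OppPoly map_MulPoly map_AmulXn.
Qed.

Lemma map_Rediv p q k k' :
  (forall c qq r, fm (k (c, qq, r)) = k' (c, pm qq, pm r)) ->
  fm (Rediv p q k) = Rediv (pm p) (pm q) k'.
Proof.
move=> kk'; apply: map_Isnull => -[]; first by rewrite kk' /= rmorph0.
do 2![apply: map_Size => ?]; apply: map_LeadCoef => ?.
by rewrite (map_Rediv_rec_loop _ _ _ _ _ _ _ kk') /= rmorph0.
Qed.

Lemma map_Rmod p q k k' : (forall r, fm (k r) = k' (pm r)) ->
  fm (Rmod p q k) = Rmod (pm p) (pm q) k'.
Proof. by move=> kk'; apply: map_Rediv => c qq r; apply: kk'. Qed.

Lemma map_Rgcd_loop n p q k k' : (forall r, fm (k r) = k' (pm r)) ->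
  fm (Rgcd_loop n p q k) = Rgcd_loop n (pm p) (pm q) k'.
Proof.
move=> kk'; elim: n p q => [|n IH] p q /=; apply: map_Rmod => r;
  apply: map_Isnull => -[]; rewrite ?kk' ?IH //.
Qed.

Lemma map_Rgcd p q k k' : (forall r, fm (k r) = k' (pm r)) ->
  fm (Rgcd p q k) = Rgcd (pm p) (pm q) k'.
Proof.
move=> kk'; apply: map_LtSize => -[]; apply: map_Isnull => -[]; rewrite ?kk' //;
  by apply: map_Size => n; apply: map_Rgcd_loop.
Qed.

Lemma map_BigRgcd ps k k' : (forall r, fm (k r) = k' (pm r)) ->
  fm (BigRgcd ps k) = BigRgcd (map pm ps) k'.
Proof.
elim: ps k k' => [|p ps IH] k k' kk' /=; first by rewrite kk' /= rmorph0.
by apply: IH => r; apply: map_Rgcd.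
Qed.

Lemma map_Changes s k k' : (forall n, fm (k n) = k' n) ->
  fm (Changes s k) = Changes (pm s) k'.
Proof.
elim: s k k' => [|a s IH] k k' kk' /=; first exact: kk'.
apply: IH => n /=; rewrite !kk'; case: s => //=.
Qed.

Lemma map_SeqPInfty ps k k' : (forall s, fm (k s) = k' (pm s)) ->
  fm (SeqPInfty ps k) = SeqPInfty (map pm ps) k'.
Proof.
elim: ps k k' => [|p ps IH] k k' kk' /=; first exact: kk'.
by apply: map_LeadCoef => l; apply: IH => s; apply: kk'.
Qed.

Lemma map_SeqMInfty ps k k' : (forall s, fm (k s) = k' (pm s)) ->
  fm (SeqMInfty ps k) = SeqMInfty (map pm ps) k'.
Proof.
elim: ps k k' => [|p ps IH] k k' kk' /=; first exact: kk'.
apply: map_LeadCoef => l; apply: map_Size => m; apply: IH => s.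
by rewrite kk' /= rmorphN rmorph1.
Qed.

Lemma map_ChangesPoly ps k k' : (forall z, fm (k z) = k' z) ->
  fm (ChangesPoly ps k) = ChangesPoly (map pm ps) k'.
Proof.
move=> kk'; apply: map_SeqMInfty => ms; apply: map_SeqPInfty => qs.
by do 2![apply: map_Changes => ?]; apply: kk'.
Qed.

Lemma map_NextMod p q k k' : (forall r, fm (k r) = k' (pm r)) ->
  fm (NextMod p q k) = NextMod (pm p) (pm q) k'.
Proof.
move=> kk'; apply: map_LeadCoef => l; apply: map_Rediv => c qq r' /=.
by apply: map_Rmod => r; rewrite kk' map_ScalPoly.
Qed.

Lemma map_ModsAux p q n k k' : (forall s, fm (k s) = k' (map pm s)) ->
  fm (ModsAux p q n k) = ModsAux (pm p) (pm q) n k'.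
Proof.
elim: n p q k k' => [|n IH] p q k k' kk' /=; first exact: kk'.
apply: map_Isnull => -[]; first exact: kk'.
by apply: map_NextMod => r; apply: IH => s; apply: kk'.
Qed.

Lemma map_Mods p q k k' : (forall s, fm (k s) = k' (map pm s)) ->
  fm (Mods p q k) = Mods (pm p) (pm q) k'.
Proof. by move=> kk'; do 2![apply: map_Size => ?]; apply: map_ModsAux. Qed.

Lemma map_PolyComb sq sc : pm (PolyComb sq sc) = PolyComb (map pm sq) sc.
Proof.
rewrite /PolyComb size_map; elim: (iota 0 (size sq)) => //= i s IH.
rewrite map_MulPoly map_ExpPoly IH; congr (MulPoly (ExpPoly _ _) _).
by have [lti|gei] := ltnP i (size sq);
  [rewrite (nth_map [::])|rewrite !nth_default ?size_map].
Qed.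

Lemma map_Pcq sq i : pm (Pcq sq i) = Pcq (map pm sq) i.
Proof.
rewrite /Pcq size_map; elim: (qe_rcf_th.sg_tab _) i => [|sc s IH] [|i] //=.
exact: map_PolyComb.
Qed.

Lemma map_TaqR p q k k' : (forall z, fm (k z) = k' z) ->
  fm (TaqR p q k) = TaqR (pm p) (pm q) k'.
Proof.
move=> kk'; rewrite /TaqR -map_Deriv -map_MulPoly; apply: map_Mods => s.
exact: map_ChangesPoly.
Qed.

Lemma map_TaqsR p sq i k k' : (forall t, fm (k t) = k' (tm t)) ->
  fm (TaqsR p sq i k) = TaqsR (pm p) (map pm sq) i k'.
Proof.
move=> kk'; rewrite /TaqsR -map_Pcq; apply: map_TaqR => z.
by rewrite kk' /= rmorph_int.
Qed.

(** These constants are rational, in general entries of the inverse of an integer matrix, and a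
    field morphism fixes them. *)
Lemma map_Coefs n i : tm (Coefs R n i) = Coefs K n i.
Proof.
rewrite /Coefs /=; congr (Const _); case: n => [|[|n]].
- by rewrite rmorph_nat.
- by move: i => [|[|[|i]]] /=; rewrite ?fmorphV ?rmorph_nat ?rmorph0 // !nth_nil rmorph0.
- rewrite /qe_rcf_th.coefs; set s := enum _.
  elim: s i => [|j s IH] [|i] //=; rewrite ?rmorph0 //.
  rewrite !castmxE; move: (qe_rcf_th.ctmat _) => C.
  have -> : invmx (map_mx intr C) = map_mx emb (invmx (map_mx intr C)).
    by rewrite map_invmx; congr invmx; apply/matrixP => x y; rewrite !mxE rmorph_int.
  by rewrite mxE.
Qed.

Lemma map_CcountWeak p sq k k' : (forall t, fm (k t) = k' (tm t)) ->
  fm (CcountWeak p sq k) = CcountWeak (pm p) (map pm sq) k'.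
Proof.
move=> kk'; rewrite /CcountWeak size_map.
rewrite -[X in _ = _ X _ _]/(tm 0).
move: (3 ^ size sq)%N 0 => n s; elim: n s k k' kk' => [|n IH] s k k' kk' /=; first exact: kk'.
by apply: map_TaqsR => t; rewrite -map_Coefs; apply: IH.
Qed.

Lemma map_BoundingPoly sq : pm (BoundingPoly sq) = BoundingPoly (map pm sq).
Proof.
rewrite /BoundingPoly map_Deriv; congr Deriv.
by elim: sq => //= q sq IH; rewrite map_MulPoly IH.
Qed.

Lemma map_CcountGt0 sp sq : fm (CcountGt0 sp sq) = CcountGt0 (map pm sp) (map pm sq).
Proof.
apply: map_BigRgcd => p; apply: map_Isnull => -[] /=; last first.
  by apply: map_CcountWeak.
rewrite -map_BoundingPoly; apply: map_CcountWeak => t /=; congr (_ \/ (_ \/ _)).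
  elim: sq => //= q sq IH; congr And => //; exact: map_LeadCoef.
elim: sq => //= q sq IH; congr And => //; apply: map_Size => n.
exact: map_LeadCoef.
Qed.

Lemma map_abstrX i t : pm (abstrX i t) = abstrX i (tm t).
Proof.
elim: t => //=.
- by move=> n; case: ifP.
- by move=> u IHu v IHv; rewrite map_AddPoly IHu IHv.
- by move=> u IHu; rewrite map_OppPoly IHu.
- by move=> u IHu n; rewrite /NatMulPoly map_ScalPoly IHu.
- by move=> u IHu v IHv; rewrite map_MulPoly IHu IHv.
- by move=> u IHu n; rewrite map_ExpPoly IHu.
Qed.

End QeNaturality.

Lemma sgz_sub_cmp (R K : realDomainType) (a b : K) (c d : R) :
  sgz (a - b) = sgz (c - d) ->
  [/\ (a == b) = (c == d), (a < b) = (c < d) & (a <= b) = (c <= d)].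
Proof.
move=> e; have e1 : (a == b) = (c == d) by rewrite -subr_eq0 -sgz_eq0 e sgz_eq0 subr_eq0.
have e2 : (a < b) = (c < d) by rewrite -subr_lt0 -sgz_lt0 e sgz_lt0 subr_lt0.
by split=> //; rewrite !le_eqVlt e1 e2.
Qed.

Section Transfer.
Import qe_rcf.
Variables (R K : rcfType) (emb : {rmorphism R -> K}).

Local Notation tm := (term_map emb).

Definition tsub (F : Type) (u v : term F) : term F := Add u (Opp v).

Fixpoint atoms (f : formula R) : seq (term R) :=
  match f with
  | Bool _ => [::]
  | Equal u v | Lt u v | Le u v => [:: tsub u v]
  | And f g | Or f g | Implies f g => atoms f ++ atoms g
  | Not f => atoms f
  end.

(* A record rather than a bare equation, to keep conversion from unfolding it. *)
Record same_sign (x : K) (y : R) : Prop := SameSign { same_signE : sgz x = sgz y }.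

Definition agree (H : seq (term R)) (e : seq K) (e' : seq R) : Prop :=
  forall h, List.In h H -> same_sign (eval e (tm h)) (eval e' h).

Lemma agree_cat H1 H2 e e' :
  agree (H1 ++ H2) e e' <-> agree H1 e e' /\ agree H2 e e'.
Proof.
split=> [a|[a1 a2] h].
  split=> h hH; apply: (a h); apply: (List.in_or_app H1 H2 h); [left|right]; exact: hH.
by move=> /(List.in_app_or H1 H2 h)[/a1|/a2].
Qed.

Lemma qf_eval_map f e e' : agree (atoms f) e e' ->
  qf_eval e (formula_map emb f) = qf_eval e' f.
Proof.
have sub_sg u v : agree [:: tsub u v] e e' ->
    sgz (eval e (tm u) - eval e (tm v)) = sgz (eval e' u - eval e' v).
  by case/(_ (tsub u v)); [left|].
elim: f => //=.
- by move=> u v /sub_sg/sgz_sub_cmp[].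
- by move=> u v /sub_sg/sgz_sub_cmp[].
- by move=> u v /sub_sg/sgz_sub_cmp[].
- by move=> f IHf g IHg /agree_cat[/IHf-> /IHg->].
- by move=> f IHf g IHg /agree_cat[/IHf-> /IHg->].
- by move=> f IHf g IHg /agree_cat[/IHf-> /IHg->].
- by move=> f IHf /IHf->.
Qed.

Definition satisfies (F : rcfType) (e : seq F) (c : seq (term F) * seq (term F)) :=
  all (fun u => eval e u == 0) c.1 && all (fun v => 0 < eval e v) c.2.

Definition eliminate (F : rcfType) (m : nat) (c : seq (term F) * seq (term F)) :=
  CcountGt0 (map (abstrX m) c.1) (map (abstrX m) c.2).

Lemma eliminateP (F : rcfType) m c (e : seq F) :
  reflect (exists x, satisfies (set_nth 0 e m x) c) (qf_eval e (eliminate m c)).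
Proof.
rewrite eval_CcountGt0; apply: (equivP (qe_rcf_th.ccount_gt0P _ _)).
by split=> -[x hx]; exists x; move: hx; rewrite !big_all /satisfies !all_map;
  congr (_ && _); apply: eq_all => u /=; rewrite abstrXP.
Qed.

Definition system_map (c : seq (term R) * seq (term R)) := (map tm c.1, map tm c.2).

Lemma eliminate_map m c :
  formula_map emb (eliminate m c) = eliminate m (system_map c).
Proof.
rewrite /eliminate map_CcountGt0 -!map_comp.
by congr CcountGt0; apply: eq_map => u /=; rewrite map_abstrX.
Qed.

(** These are all complete sign conditions on [H], three choices for each term; a negative sign is
    encoded as positivity of [Opp h]. *)
Fixpoint sign_systems (F : Type) (H : seq (term F)) : seq (seq (term F) * seq (term F)) :=
  if H is h :: H' then
    flatten [seq [:: (h :: c.1, c.2); (c.1, h :: c.2); (c.1, Opp h :: c.2)]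
            | c <- sign_systems H']
  else [:: ([::], [::])].

Lemma In_flatten_map (T1 T2 : Type) (f : T1 -> seq T2) s x :
  List.In x (flatten (map f s)) <-> exists2 y, List.In y s & List.In x (f y).
Proof.
elim: s => [|y s IH] /=; first by split=> // -[].
split=> [/List.in_app_iff[xy|/IH[z zs xz]]|[z [<- xy|zs xz]]].
- by exists y => //; left.
- by exists z => //; right.
- by apply/List.in_app_iff; left.
- by apply/List.in_app_iff; right; apply/IH; exists z.
Qed.

Lemma sgz_cases (F : realDomainType) (x : F) :
  [\/ x = 0, 0 < x | 0 < - x].
Proof.
by case: (ltrgt0P x) => h; [constructor 2|constructor 3; rewrite oppr_gt0|constructor 1].
Qed.

Lemma sign_systems_small H (e : seq R) :
  exists2 c, List.In c (sign_systems H) & satisfies e c.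
Proof.
elim: H => [|h H [c cH /andP[c1 c2]]]; first by exists ([::], [::]); [left|].
have mem_c d : List.In d [:: (h :: c.1, c.2); (c.1, h :: c.2); (c.1, Opp h :: c.2)] ->
    List.In d (sign_systems (h :: H)) by move=> dc; apply/In_flatten_map; exists c.
case: (sgz_cases (eval e h)) => eh.
- by exists (h :: c.1, c.2); [apply: mem_c; left|rewrite /satisfies /= eh eqxx c1].
- by exists (c.1, h :: c.2); [apply: mem_c; right; left|rewrite /satisfies /= eh c1].
- by exists (c.1, Opp h :: c.2); [apply: mem_c; right; right; left|rewrite /satisfies /= eh c1].
Qed.

Lemma sign_systems_big H (e : seq K) :
  exists2 c, List.In c (sign_systems H) & satisfies e (system_map c).
Proof.
elim: H => [|h H [c cH /andP[c1 c2]]]; first by exists ([::], [::]); [left|].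
rewrite /= in c1 c2.
have mem_c d : List.In d [:: (h :: c.1, c.2); (c.1, h :: c.2); (c.1, Opp h :: c.2)] ->
    List.In d (sign_systems (h :: H)) by move=> dc; apply/In_flatten_map; exists c.
case: (sgz_cases (eval e (tm h))) => eh.
- by exists (h :: c.1, c.2); [apply: mem_c; left|rewrite /satisfies /= eh eqxx c1].
- by exists (c.1, h :: c.2); [apply: mem_c; right; left|rewrite /satisfies /= eh c1].
- by exists (c.1, Opp h :: c.2); [apply: mem_c; right; right; left|rewrite /satisfies /= eh c1].
Qed.

Lemma sign_systems_agree H c e e' : List.In c (sign_systems H) ->
  satisfies e (system_map c) -> satisfies e' c -> agree H e e'.
Proof.
elim: H c => [|h H IH] c; first by move=> _ _ _ ? [].
move=> /In_flatten_map[d dH] cd sc sc'.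
suff [eh sd sd'] : [/\ same_sign (eval e (tm h)) (eval e' h),
    satisfies e (system_map d) & satisfies e' d].
  by move=> g [<- //|gH]; apply: (IH d).
case: cd sc sc' => [<-|[<-|[<-|//]]]; rewrite /satisfies /=.
- move=> /andP[/andP[/eqP e1 ->] ->] /andP[/andP[/eqP e2 ->] ->].
  by split=> //; split; rewrite e1 e2 !sgz0.
- move=> /andP[-> /andP[e1 ->]] /andP[-> /andP[e2 ->]].
  by split=> //; split; rewrite !gtr0_sgz.
- move=> /andP[-> /andP[e1 ->]] /andP[-> /andP[e2 ->]].
  by rewrite !oppr_gt0 in e1 e2; split=> //; split; rewrite !ltr0_sgz.
Qed.

(** For a complete sign condition on [H], the existence of a value of variable [m] that realizes it
    is a quantifier-free formula, the same over both fields up to [emb]. [H'] collects the atoms of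
    these formulas, so that a move on either side can be answered on the other. *)
Lemma back_and_forth (H : seq (term R)) m : exists H' : seq (term R),
  forall (e : seq K) (e' : seq R), agree H' e e' ->
    (forall t, exists t', agree H (set_nth 0 e m t) (set_nth 0 e' m t')) /\
    (forall t', exists t, agree H (set_nth 0 e m t) (set_nth 0 e' m t')).
Proof.
exists (flatten [seq atoms (eliminate m c) | c <- sign_systems H]) => e e' ee'.
have elim_eq c : List.In c (sign_systems H) ->
    qf_eval e (eliminate m (system_map c)) = qf_eval e' (eliminate m c).
  move=> cH; rewrite -eliminate_map; apply: qf_eval_map => h hc; apply: ee'.
  by apply/In_flatten_map; exists c.
split=> t.
  have [c cH sc] := sign_systems_big H (set_nth 0 e m t).
  have : qf_eval e (eliminate m (system_map c)) by apply/eliminateP; exists t.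
  rewrite elim_eq // => /eliminateP[t' sc']; exists t'.
  exact: sign_systems_agree cH sc sc'.
have [c cH sc] := sign_systems_small H (set_nth 0 e' m t).
have : qf_eval e' (eliminate m c) by apply/eliminateP; exists t.
rewrite -elim_eq // => /eliminateP[t' sc']; exists t'.
exact: sign_systems_agree cH sc' sc.
Qed.

Hypothesis emb_ge0 : order_embedding emb.

Lemma eq_eval (F : rcfType) (e1 e2 : seq F) h :
  (forall i, e1`_i = e2`_i) -> eval e1 h = eval e2 h.
Proof.
by move=> e12; elim: h => //=; do ?[move=> ? ->|move=> ?].
Qed.

Lemma eval_emb (e : seq K) (e' : seq R) h : (forall i, e`_i = emb e'`_i) ->
  eval e (tm h) = emb (eval e' h).
Proof.
move=> ee'; elim: h => //=.
- by move=> n; rewrite rmorph_nat.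
- by move=> u -> v ->; rewrite rmorphD.
- by move=> u ->; rewrite rmorphN.
- by move=> u -> n; rewrite rmorphMn.
- by move=> u -> v ->; rewrite rmorphM.
- by move=> u -> n; rewrite rmorphXn.
Qed.

Lemma sgz_emb x : sgz (emb x) = sgz x.
Proof.
by rewrite !sgz_def fmorph_eq0 -(rmorph0 emb) embedding_lt.
Qed.

(* Tarski's transfer principle, moving one coordinate at a time into [R]. *)
Theorem transfer n (H : seq (term R)) (a : seq K) (x0 : seq R) :
  (forall i, (n <= i)%N -> a`_i = emb x0`_i) -> exists x, agree H a x.
Proof.
elim: n => [|n IH] in H a x0 *.
  move=> ax0; exists x0 => h _; split.
  by rewrite (eval_emb _ (fun i => ax0 i isT)) sgz_emb.
move=> ax0; have [H' H'P] := back_and_forth H n.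
(* Coordinate [n] is reset to 0 on both sides, which leaves one coordinate fewer outside [R]; the
   true value over [K] is then put back by [back_and_forth]. *)
have [i ni|x xP] := IH H' (set_nth 0 a n 0) (set_nth 0 x0 n 0).
  rewrite !nth_set_nth /=; case: eqP => [|/eqP ne]; rewrite ?rmorph0 //.
  by rewrite ax0 // ltn_neqAle eq_sym ne.
have [t' t'P] := (H'P _ _ xP).1 a`_n; exists (set_nth 0 x n t') => h hH.
split; rewrite -(same_signE (t'P h hH)); congr sgz; apply: eq_eval => i.
have [->|ne] := eqVneq i n; first by rewrite nth_set_nth /= eqxx.
by rewrite !(nth_set_nth, negPf ne) /= (negPf ne) nth_set_nth /= (negPf ne).
Qed.

End Transfer.

(** * Coefficient fields of convex subrings *)

Record convex_subring (K : rcfType) (V : set K) : Prop := ConvexSubring {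
  cvx1 : V 1;
  cvxB : forall x y, V x -> V y -> V (x - y);
  cvxM : forall x y, V x -> V y -> V (x * y);
  cvx_le : forall x y, `|x| <= `|y| -> V y -> V x
}.

Record subfield_set (K : fieldType) (k : set K) : Prop := SubfieldSet {
  sf1 : k 1;
  sfB : forall x y, k x -> k y -> k (x - y);
  sfM : forall x y, k x -> k y -> k (x * y);
  sfV : forall x, k x -> k x^-1
}.

Section SubfieldPoly.
Variables (K : fieldType) (k : set K) (sf_k : subfield_set k).

Definition subfield_pred of subfield_set k : pred K := fun x => `[< k x >].
Local Notation kP := (subfield_pred sf_k).

Lemma subfield_predP x : reflect (k x) (x \in kP).
Proof. exact: asboolP. Qed.

Fact subfield_pred_divring : divring_closed kP.
Proof.
split; first by apply/subfield_predP/(sf1 sf_k).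
  by move=> x y /subfield_predP kx /subfield_predP ky; apply/subfield_predP/(sfB sf_k).
move=> x y /subfield_predP kx /subfield_predP ky; apply/subfield_predP.
by apply: (sfM sf_k) => //; exact: (sfV sf_k).
Qed.

HB.instance Definition _ := GRing.isDivringClosed.Build K kP subfield_pred_divring.

Definition polys_over : set {poly K} := [set p | p \is a polyOver kP].

Lemma polys_overB p q : polys_over p -> polys_over q -> polys_over (p - q).
Proof. exact: rpredB. Qed.

Lemma polys_overM p q : polys_over p -> polys_over q -> polys_over (p * q).
Proof. exact: rpredM. Qed.

Lemma polys_overC c : k c -> polys_over c%:P.
Proof. by move=> kc; rewrite /polys_over /= polyOverC; apply/subfield_predP. Qed.

Lemma polys_overX : polys_over 'X.
Proof. exact: polyOverX. Qed.

Lemma polys_over_deriv p : polys_over p -> polys_over p^`().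
Proof. exact: polyOver_deriv. Qed.

Lemma polys_over_coef p i : polys_over p -> k p`_i.
Proof. by move=> /polyOverP/(_ i)/subfield_predP. Qed.

Lemma polys_over_reduce s q : polys_over s -> polys_over q -> q != 0 ->
  (size q <= size s)%N ->
  exists r t, [/\ polys_over r, s = r + t * q & (size r < size s)%N].
Proof.
move=> ks kq q0 qs; have s0 : s != 0.
  by rewrite -size_poly_gt0 (leq_trans _ qs) // size_poly_gt0.
pose t := (lead_coef s / lead_coef q) *: 'X^(size s - size q).
have kt : polys_over t.
  rewrite /t -mul_polyC; apply: polys_overM; last first.
    exact: polyOverXn.
  apply: polys_overC; apply: (sfM sf_k); first exact: polys_over_coef.
  by apply: (sfV sf_k); exact: polys_over_coef.
exists (s - t * q), t; split; [|by rewrite subrK|].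
  by apply: polys_overB => //; exact: polys_overM.
have lq : lead_coef q != 0 by rewrite lead_coef_eq0.
have szt : size (t * q) = size s.
  rewrite /t -scalerAl size_scale; last by rewrite mulf_neq0 ?invr_neq0 // lead_coef_eq0.
  by rewrite mulrC size_mulXn // subnK.
have lt_s : lead_coef (t * q) = lead_coef s.
  by rewrite lead_coefM /t lead_coefZ lead_coefXn mulr1 divfK.
rewrite -[size s]prednK ?size_poly_gt0 // ltnS; apply/leq_sizeP => j.
rewrite leq_eqVlt => /predU1P[<-|sj].
  by rewrite coefB -lead_coefE -szt -lead_coefE lt_s subrr.
have sj' : (size s <= j)%N by move: sj; rewrite prednK ?size_poly_gt0.
by rewrite coefB !nth_default ?subrr ?szt.
Qed.

End SubfieldPoly.

Section CoefficientField.
(** The hypotheses make [V] a convex local ring with maximal ideal [m], which is convex too: its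
    elements act as the infinitesimals. *)
Variables (K : rcfType) (V m : set K).
Hypothesis cvxV : convex_subring V.
Hypothesis m0 : m 0.
Hypothesis mD : forall x y, m x -> m y -> m (x + y).
Hypothesis mM : forall x y, m x -> V y -> m (x * y).
Hypothesis m_le : forall x y, `|x| <= `|y| -> m y -> m x.
Hypothesis mV : forall x, m x -> V x.
Hypothesis m1 : ~ m 1.
Hypothesis VmV : forall x, V x -> ~ m x -> V x^-1.

Let V0 : V 0. Proof. by rewrite -(subrr 1); apply: (cvxB cvxV); exact: (cvx1 cvxV). Qed.
Let VN x : V x -> V (- x). Proof. by rewrite -sub0r; apply: (cvxB cvxV). Qed.
Let VD x y : V x -> V y -> V (x + y).
Proof. by move=> Vx Vy; rewrite -[y]opprK; apply: (cvxB cvxV) => //; exact: VN. Qed.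
Let VM := cvxM cvxV.
Let mN x : m x -> m (- x). Proof. by apply: m_le; rewrite normrN. Qed.

Let V_deriv (q : {poly K}) : (forall i, V q`_i) -> forall i, V q^`()`_i.
Proof.
move=> Vq i; rewrite coef_deriv; move: (q`_i.+1) (Vq i.+1) => x Vx.
by elim: i.+1 => [|n IH]; [rewrite mulr0n|rewrite mulrS; apply: VD].
Qed.

Lemma horner_in_V (p : {poly K}) u : (forall i, V p`_i) -> V u -> V p.[u].
Proof.
elim/poly_ind: p => [|p c IH] Vp Vu; first by rewrite horner0.
rewrite hornerMXaddC; apply: VD; last by have := Vp 0%N; rewrite coefD coefMX coefC /= add0r.
by apply: VM => //; apply: IH => // i; have := Vp i.+1; rewrite coefD coefMX coefC /= addr0.
Qed.

Lemma horner_congr (p : {poly K}) u v : (forall i, V p`_i) -> V u -> V v ->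
  m (u - v) -> m (p.[u] - p.[v]).
Proof.
move=> Vp Vu Vv muv;
elim/poly_ind: p Vp => [|p c IH] Vp; first by rewrite !horner0 subrr.
have Vp' i : V p`_i by have := Vp i.+1; rewrite coefD coefMX coefC /= addr0.
rewrite !hornerMXaddC opprD addrACA subrr addr0.
have -> : p.[u] * u - p.[v] * v = (p.[u] - p.[v]) * u + (u - v) * p.[v].
  by rewrite !mulrBl addrA [u * _]mulrC subrK [v * _]mulrC.
apply: mD; first exact: mM (IH Vp') Vu.
by apply: mM muv _; exact: horner_in_V Vp' Vv.
Qed.

Lemma taylor2 (q : {poly K}) u z : (forall i, V q`_i) -> V u -> V z ->
  exists2 c, V c & q.[u + z] = q.[u] + q^`().[u] * z + z ^+ 2 * c.
Proof.
move=> Vq Vu Vz; elim/poly_ind: q Vq => [|q c IH] Vq.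
  by exists 0 => //; rewrite deriv0 !horner0 mul0r mulr0 !addr0.
have Vq' i : V q`_i by have := Vq i.+1; rewrite coefD coefMX coefC /= addr0.
have [d Vd qd] := IH Vq'; exists (q^`().[u] + d * (u + z)).
  apply: VD; last by apply: VM => //; exact: VD.
  by apply: horner_in_V => //; exact: V_deriv.
by rewrite derivD derivM derivX derivC !hornerE qd; lra.
Qed.

(** This is a form of Hensel's lemma, with the intermediate value theorem instead of an iteration.
    Let [s] be the derivative at [u] and [w = q.[u] / s], which is in [m]. When [|z| = 2|w|], the
    Taylor formula turns [q.[u + z] / s] into [w + z + z * e] with [e] in [m], hence [|e| <= 1/2].
    As [|w| = |z| / 2], this value is zero or has the sign of [z], so there is a root at distance at
    most [2|w|] from [u]. *)
Lemma newton_root (q : {poly K}) u : (forall i, V q`_i) -> V u ->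
  m q.[u] -> ~ m q^`().[u] -> exists2 b, root q b & m (b - u).
Proof.
move=> Vq Vu mq nmq'; set s := q^`().[u] in nmq'.
have s0 : s != 0 by apply/eqP => e; rewrite e in nmq'.
have Vs : V s.
  by apply: horner_in_V => //; exact: V_deriv.
pose w := q.[u] / s; have mw : m w by apply: mM => //; exact: VmV.
pose rho := 2%:R * `|w|.
have mrho : m rho.
  by rewrite /rho mulr_natl mulr2n; apply: mD; apply: m_le mw; rewrite normr_id.
have sign_at z : `|z| = rho -> (q.[u + z] / s) * z >= 0.
  move=> zrho; have mz : m z by apply: m_le mrho; rewrite zrho ger0_norm // mulr_ge0.
  have [c Vc ->] := taylor2 Vq Vu (mV mz).
  pose e := z * c / s; have me : m e.
    by apply: mM; [exact: mM|exact: VmV].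
  have e_small : `|e| <= 2%:R^-1.
    rewrite leNgt; apply/negP => lt_e; apply: m1; apply: (@m_le _ (e + e)); last exact: mD.
    rewrite normr1 -mulr2n normrMn -mulr_natl -(ler_pdivrMl _ _ (_ : 0 < 2%:R :> K)) //.
    by rewrite mulr1 ltW.
  have -> : (q.[u] + s * z + z ^+ 2 * c) / s * z = (w + z + z * e) * z.
    congr (_ * z); rewrite 2!mulrDl /w /e; congr (_ + _ + _).
      by rewrite mulrAC mulfV // mul1r.
    by rewrite expr2 !mulrA.
  have wz : `|w| = `|z| / 2%:R by rewrite zrho /rho mulrAC mulfV ?mul1r // pnatr_eq0.
  have -> : (w + z + z * e) * z = z ^+ 2 * (1 + e) + w * z by rewrite !mulrDl expr2; lra.
  have : - (`|w| * `|z|) <= w * z by rewrite -normrM lerNnormlW.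
  have : z ^+ 2 = `|z| * `|z| by rewrite -expr2 real_normK ?num_real.
  rewrite wz => -> h.
  have : - 2%:R^-1 <= e by rewrite lerNnormlW // e_small.
  have : 0 <= `|z| * `|z| by rewrite mulr_ge0.
  nra.
have rho0 : 0 <= rho by rewrite mulr_ge0.
have [rho_eq0|rho_neq0] := eqVneq rho 0.
  exists u; last by rewrite subrr.
  move/eqP: rho_eq0; rewrite mulf_eq0 pnatr_eq0 /= normr_eq0 mulf_eq0 invr_eq0.
  by rewrite (negPf s0) orbF.
have rho_gt0 : 0 < rho by rewrite lt_neqAle eq_sym rho_neq0.
have ps z : (s^-1 *: q).[z] = q.[z] / s by rewrite hornerZ mulrC.
have [| |b /andP[ub bu] rb] := @poly_ivt K (s^-1 *: q) (u - rho) (u + rho).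
- by rewrite lerBlDr -addrA lerDl addr_ge0.
- rewrite !ps; have := sign_at rho (ger0_norm rho0); have := sign_at (- rho).
  rewrite normrN ger0_norm // => /(_ erefl).
  by rewrite mulrN oppr_ge0 pmulr_lle0 // pmulr_lge0 // => -> ->.
exists b; first by move: rb; rewrite rootZ // invr_eq0.
apply: m_le mrho; rewrite [`|rho|]ger0_norm // ler_norml.
by apply/andP; split; lra.
Qed.

Variables (k0 : set K) (sf_k0 : subfield_set k0).
Hypothesis k0V : k0 `<=` V.

Lemma maximal_subfield : exists k : set K, [/\ subfield_set k, k `<=` V, k0 `<=` k &
  forall k', subfield_set k' -> k' `<=` V -> k `<=` k' -> k' `<=` k].
Proof.
have [||k [[sf_k kV] k0k maxk]] := @Zorn_above K (fun k => subfield_set k /\ k `<=` V) k0.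
- by [].
- move=> F [X0 FX0] FP totF; split; last by move=> x [X FX Xx]; exact: (FP X FX).2.
  have sfF X : F X -> subfield_set X by move=> /FP[].
  split.
  + by exists X0 => //; exact: (sf1 (sfF _ FX0)).
  + move=> a b Ua Ub; have [X [FX Xa Xb]] := chain_common totF Ua Ub.
    by exists X => //; exact: (sfB (sfF _ FX)).
  + move=> a b Ua Ub; have [X [FX Xa Xb]] := chain_common totF Ua Ub.
    by exists X => //; exact: (sfM (sfF _ FX)).
  + by move=> a [X FX Xa]; exists X => //; exact: (sfV (sfF _ FX)).
by exists k; split=> // k' sf_k' k'V; exact: maxk.
Qed.

Lemma subfield_meets_m k b : subfield_set k -> k `<=` V -> k b -> m b -> b = 0.
Proof.
move=> sf_k kV kb mb; apply: contrapT => /eqP b0; apply: m1.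
by rewrite -(divff b0); apply: mM => //; apply: kV; exact: (sfV sf_k).
Qed.

Section Maximal.
Variables (k : set K) (sf_k : subfield_set k) (kV : k `<=` V).
Hypothesis maxk : forall k', subfield_set k' -> k' `<=` V -> k `<=` k' -> k' `<=` k.

Local Notation kX := (polys_over sf_k).

(** The nonzero values at [w] of polynomials over [k] are units of [V], so the field generated by
    [k] and [w] stays in [V]; by maximality it is [k]. *)
Lemma maximal_subfield_adjoin w : V w ->
  (forall s, kX s -> s.[w] = 0 \/ ~ m s.[w]) -> k w.
Proof.
move=> Vw kw; pose k' := [set x | exists s t, [/\ kX s, kX t, t.[w] != 0 & x = s.[w] / t.[w]]].
have k1 : kX 1 by apply: (polys_overC sf_k); exact: (sf1 sf_k).
have coefV p : kX p -> forall i, V p`_i by move=> kp i; apply/kV/(polys_over_coef _ kp).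
apply: (maxk (k' := k')).
- split.
  + by exists 1, 1; rewrite hornerC oner_eq0 divr1.
  + move=> _ _ [s [t [ks kt t0 ->]]] [s' [t' [ks' kt' t'0 ->]]].
    exists (s * t' - s' * t), (t * t'); split.
    * by apply: polys_overB; exact: polys_overM.
    * exact: polys_overM.
    * by rewrite hornerM mulf_neq0.
    * by rewrite -mulNr addf_div // !hornerE mulNr.
  + move=> _ _ [s [t [ks kt t0 ->]]] [s' [t' [ks' kt' t'0 ->]]].
    exists (s * s'), (t * t'); split; [exact: polys_overM|exact: polys_overM| |].
      by rewrite hornerM mulf_neq0.
    by rewrite !hornerM mulrACA invfM.
  + move=> _ [s [t [ks kt t0 ->]]]; have [s0|s0] := eqVneq s.[w] 0.
      by exists 0, 1; rewrite s0 mul0r invr0 horner0 mul0r hornerC oner_eq0;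
        split=> //; rewrite /polys_over /= rpred0.
    by exists t, s; rewrite invf_div.
- move=> _ [s [t [ks kt t0 ->]]]; apply: VM; first exact: horner_in_V (coefV _ ks) Vw.
  have [/eqP|nm] := kw t kt; first by rewrite (negPf t0).
  by apply: VmV nm; exact: horner_in_V (coefV _ kt) Vw.
- move=> c kc; exists c%:P, 1; rewrite !hornerC oner_eq0 divr1; split=> //.
  exact: polys_overC.
- exists 'X, 1; rewrite hornerX hornerC oner_eq0 divr1; split=> //; exact: polys_overX.
Qed.

(* If the residue of [u] is algebraic over [k], Newton's method moves [u] to a
   root of a polynomial over [k] of minimal degree; by maximality this root, or
   [u] itself when its residue is transcendental, is in [k]. *)
Lemma maximal_subfield_residue u : V u -> exists2 b, k b & m (u - b).
Proof.
move=> Vu; have coefV p : kX p -> forall i, V p`_i by move=> kp i; apply/kV/(polys_over_coef _ kp).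
have [alg|transc] := pselect (exists n, `[< exists q, [/\ kX q, q != 0, m q.[u] & size q = n] >]).
  have [n /asboolP[q [kq q0 mq szq]] minn] := ex_minnP alg.
  have minq s : kX s -> s != 0 -> (size s < size q)%N -> ~ m s.[u].
    move=> ks s0; rewrite szq ltnNge => /negP + ms; apply; apply: minn.
    by apply/asboolP; exists s.
  have [qc|sz1] := leqP (size q) 1%N.
    have e := size1_polyC qc; rewrite e hornerC in mq q0.
    by case/negP: q0; rewrite (subfield_meets_m sf_k kV (polys_over_coef 0 kq) mq).
  (* In characteristic 0 the derivative is nonzero, and its degree is below the minimal one. *)
  have nmq' : ~ m q^`().[u].
    apply: minq; [exact: polys_over_deriv| |exact: lt_size_deriv].
    by rewrite -size_poly_gt0 polyorder.size_deriv -subn1 subn_gt0.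
  have [b rb mbu] := newton_root (coefV _ kq) Vu mq nmq'.
  have Vb : V b by rewrite -(subrK u b); apply: VD => //; exact: mV.
  exists b; last by rewrite -opprB; exact: mN.
  (* Dividing by [q], which vanishes at [b], reduces to polynomials shorter than [q]. For those the
     minimality of [q] at [u] carries over to [b], because values at [u] and [b] are congruent
     modulo [m]. *)
  apply: maximal_subfield_adjoin => // s; have [n'] := ubnP (size s).
  elim: n' => // n' IH in s *; rewrite ltnS => szs ks.
  have [lt_sq|le_qs] := ltnP (size s) (size q).
    have [->|s0] := eqVneq s 0; first by left; rewrite horner0.
    right=> msb; apply: (minq s ks s0 lt_sq).
    rewrite -(subrK s.[b] s.[u]); apply: mD => //.
    by apply: horner_congr (coefV _ ks) Vu Vb _; rewrite -opprB; exact: mN.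
  have [r [t [kr e szr]]] := polys_over_reduce ks kq q0 le_qs.
  rewrite e hornerD hornerM (rootP rb) mulr0 addr0; apply: IH => //.
    exact: leq_trans szr szs.
exists u; last by rewrite subrr.
apply: maximal_subfield_adjoin => // s ks; have [->|s0] := eqVneq s 0.
  by left; rewrite horner0.
by right=> ms; apply: transc; exists (size s); apply/asboolP; exists s.
Qed.

End Maximal.
End CoefficientField.

(** * Specializations in the real spectrum *)

Section MpolyMorphisms.
Variables (n : nat) (R : comNzRingType).

Lemma mpoly_alg_ind (P : mpoly n R -> Prop) :
  (forall c, P (mpolyC n c)) -> (forall i, P (mpolyX R (mnm1 i))) ->
  (forall p q, P p -> P q -> P (p + q)) ->
  (forall p q, P p -> P q -> P (p * q)) -> forall p, P p.
Proof.
move=> PC PX PD PM; elim/mpolyind => [|c m p _ _ Pp]; first by rewrite -(mpolyC0 n R).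
apply: (PD) => //; rewrite -mul_mpolyC; apply: (PM) => //.
rewrite mpolyXE_id; elim/big_ind: _ => [||i _]; [by rewrite -(mpolyC1 n R)|exact: PM|].
by elim: (m i) => [|k IH]; [rewrite expr0 -(mpolyC1 n R)|rewrite exprS; apply: (PM)].
Qed.

Lemma mmap_morphism (S : comNzRingType) (phi : {rmorphism mpoly n R -> S}) p :
  phi p = mmap (phi \o @mpolyC n R) (fun i => phi (mpolyX R (mnm1 i))) p.
Proof.
elim/mpoly_alg_ind: p => [c|i|p q IHp IHq|p q IHp IHq].
- by rewrite mmapC.
- by rewrite mmapX mmap1U.
- by rewrite !rmorphD /= IHp IHq.
- by rewrite !rmorphM /= IHp IHq.
Qed.

End MpolyMorphisms.

Lemma embedding_rcf (R : rcfType) (K : realFieldType) (f : {rmorphism R -> K}) :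
  order_embedding f.
Proof. by move=> x x0; rewrite -(sqr_sqrtr x0) rmorphXn /= sqr_ge0. Qed.

Lemma sper_point (R : rcfType) (n : nat) (alpha : sper (mpoly n R)) :
  exists (K : rcfType) (emb : {rmorphism R -> K}) (a : 'I_n -> K),
    forall f, ge0_at f alpha <-> 0 <= mmap emb a f.
Proof.
have [F [phi [phiP _]]] := sper_field alpha.
have [K [psi psi0]] := real_closed_extension F.
pose h : {rmorphism mpoly n R -> K} := psi \o phi.
exists K, (h \o @mpolyC n R), (fun i => h (mpolyX R (mnm1 i))) => f.
by rewrite -(mmap_morphism h) /h /= embedding_ge0.
Qed.

Section Specialization.
Variables (R : rcfType) (n : nat).
Local Notation A := (mpoly n R).
Variables (gamma : sper A) (K : rcfType) (emb : {rmorphism R -> K}) (a : 'I_n -> K).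

Local Notation ev := (mmap emb a).
Hypothesis gamma_ev : forall f, gt0_at f gamma -> 0 < ev f.

(* [gamma] is a specialization of the point of the real spectrum given by [a].
   The convex subring below lies over the localization of [A] at the support of
   [gamma]; its residue field contains k(gamma). *)
Definition gamma_bounded : set K :=
  [set u | exists h e, gt0_at e gamma /\ ev e * `|u| <= ev h].
(** For nonzero [u] this is the negation of the boundedness of [u^-1], with denominators cleared: it
    describes the nonunits of [gamma_bounded]. *)
Definition gamma_small : set K :=
  [set u | forall h e, gt0_at e gamma -> ev h * `|u| < ev e].

Let gt0_1 : gt0_at (1 : A) gamma.
Proof. by apply/gt0_atP; exact: (coneN1 (ge0_at_cone gamma)). Qed.

Let gt0M e e' : gt0_at e gamma -> gt0_at e' gamma -> gt0_at (e * e') gamma.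
Proof.
move=> [e0 en] [e'0 e'n]; split; first exact: (coneM (ge0_at_cone gamma)).
exact: evalSM_neq0.
Qed.

Lemma gamma_bounded_convex : convex_subring gamma_bounded.
Proof.
split.
- by exists 1, 1; rewrite rmorph1 normr1 mulr1.
- move=> x y [h [e [eg xh]]] [h' [e' [eg' yh']]].
  exists (e' * h + e * h'), (e * e'); split; first exact: gt0M.
  have [e0 e'0] := (gamma_ev eg, gamma_ev eg'); rewrite rmorphD !rmorphM.
  have := ler_wpM2l (ltW e'0) xh; have := ler_wpM2l (ltW e0) yh'.
  have := ler_wpM2l (mulr_ge0 (ltW e0) (ltW e'0)) (ler_normB x y); lra.
- move=> x y [h [e [eg xh]]] [h' [e' [eg' yh']]].
  exists (h * h'), (e * e'); split; first exact: gt0M.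
  have [e0 e'0] := (gamma_ev eg, gamma_ev eg'); rewrite !rmorphM normrM mulrACA.
  by apply: ler_pM => //; rewrite mulr_ge0 // ltW.
- move=> x y xy [h [e [eg yh]]]; exists h, e; split=> //.
  by apply: le_trans yh; rewrite ler_wpM2l // ltW // gamma_ev.
Qed.

Lemma gamma_small0 : gamma_small 0.
Proof. by move=> h e /gamma_ev; rewrite normr0 mulr0. Qed.

Lemma gamma_small_le x y : `|x| <= `|y| -> gamma_small y -> gamma_small x.
Proof.
move=> xy sy h e eg; have := sy h e eg.
have [h0|h0] := leP 0 (ev h); first by apply: le_lt_trans; exact: ler_wpM2l.
move=> _; apply: le_lt_trans (gamma_ev eg).
by rewrite mulr_le0_ge0 // ltW.
Qed.

Lemma gamma_smallD x y : gamma_small x -> gamma_small y -> gamma_small (x + y).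
Proof.
move=> sx sy h e eg; have := sx (2%:R * h) e eg; have := sy (2%:R * h) e eg.
have [h0|h0] := leP 0 (ev h); last first.
  move=> _ _; apply: le_lt_trans (gamma_ev eg).
  by rewrite mulr_le0_ge0 // ltW.
rewrite !rmorphM rmorph_nat /= -mulrA => lt_y; rewrite -mulrA => lt_x.
have := ler_wpM2l h0 (ler_normD x y); lra.
Qed.

Lemma gamma_smallM x y : gamma_small x -> gamma_bounded y -> gamma_small (x * y).
Proof.
move=> sx [h [e [eg yh]]] g d dg.
have [g0|g0] := leP 0 (ev g); last first.
  apply: le_lt_trans (gamma_ev dg); by rewrite mulr_le0_ge0 // ltW.
have := sx (g * h) (d * e) (gt0M dg eg); rewrite !rmorphM /= => lt.
have e0 := gamma_ev eg; rewrite -(ltr_pM2r e0); apply: le_lt_trans lt.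
have := ler_wpM2l (mulr_ge0 g0 (normr_ge0 x)) yh; rewrite normrM; lra.
Qed.

Lemma gamma_small_bounded x : gamma_small x -> gamma_bounded x.
Proof.
move=> sx; exists 1, 1; split=> //.
by have := sx 1 1 gt0_1; rewrite rmorph1 => /ltW.
Qed.

Lemma gamma_smallN1 : ~ gamma_small 1.
Proof. by move=> /(_ 1 1 gt0_1); rewrite rmorph1 normr1 mulr1 ltxx. Qed.

Lemma gamma_bounded_inv x : gamma_bounded x -> ~ gamma_small x -> gamma_bounded x^-1.
Proof.
move=> _ /existsNP[h /existsNP[e /not_implyP[eg /negP]]]; rewrite -leNgt => lt.
have e0 := gamma_ev eg; exists h, e; split=> //.
have x0 : x != 0 by apply/eqP => x0; move: lt; rewrite x0 normr0 mulr0 leNgt e0.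
by rewrite normfV ler_pdivrMr ?normr_gt0.
Qed.

(** Adding a multiple of [f] to [e] does not change its value at [gamma]. So [e + h * f] and
    [e - h * f] are positive at [gamma], and hence at the point [a]. *)
Lemma ev_small f : evalS f gamma = 0 -> gamma_small (ev f).
Proof.
move=> f0 h e eg.
have shift g : evalS g gamma = 0 -> gt0_at (e + g) gamma.
  by move=> g0; case: eg => e0 en; split; rewrite /ge0_at evalSD g0 addr0.
have lt1 : 0 < ev (e + h * f) by apply/gamma_ev/shift; rewrite evalSM f0 mulr0.
have lt2 : 0 < ev (e - h * f) by apply/gamma_ev/shift; rewrite evalSN evalSM f0 mulr0 oppr0.
move: lt1 lt2; rewrite rmorphB rmorphD rmorphM /=.
by case: (ger0P (ev f)) => _; lra.
Qed.

Lemma ev_not_small f : gt0_at f gamma -> ~ gamma_small (ev f).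
Proof.
move=> fg /(_ 1 f fg); rewrite rmorph1 mul1r gtr0_norm ?ltxx //; exact: gamma_ev.
Qed.

Lemma ev_bounded f : gamma_bounded (ev f).
Proof.
exists (f ^+ 2 + 1), 1; split=> //; rewrite rmorph1 mul1r rmorphD rmorphXn rmorph1 /=.
by rewrite -real_normK ?num_real //; have := normr_ge0 (ev f); nra.
Qed.

Lemma mmap_congr (u v : 'I_n -> K) f :
  (forall i, gamma_bounded (u i)) -> (forall i, gamma_bounded (v i)) ->
  (forall i, gamma_small (u i - v i)) ->
  gamma_bounded (mmap emb u f) /\ gamma_small (mmap emb u f - mmap emb v f).
Proof.
move=> bu bv suv; have cvx := gamma_bounded_convex.
have emb_bounded c : gamma_bounded (emb c).
  by rewrite -[emb c](mmapC a emb); exact: ev_bounded.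
suff : forall f, [/\ gamma_bounded (mmap emb u f), gamma_bounded (mmap emb v f) &
    gamma_small (mmap emb u f - mmap emb v f)] by move=> /(_ f)[].
elim/mpoly_alg_ind=> [c|i|p q [bpu bpv sp] [bqu bqv sq]|p q [bpu bpv sp] [bqu bqv sq]].
- rewrite !mmapC subrr.
  by split; [exact: emb_bounded|exact: emb_bounded|exact: gamma_small0].
- by rewrite !mmapX !mmap1U.
- rewrite !rmorphD /=.
  have D x y : gamma_bounded x -> gamma_bounded y -> gamma_bounded (x + y).
    move=> bx b_y; rewrite -[y]opprK; apply: (cvxB cvx) => //.
    by rewrite -sub0r; apply: (cvxB cvx) => //; rewrite -(rmorph0 emb).
  split; [exact: D|exact: D|].
  by rewrite opprD addrACA; exact: gamma_smallD.
- rewrite !rmorphM /=; split; [exact: (cvxM cvx)|exact: (cvxM cvx)|].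
  have -> : mmap emb u p * mmap emb u q - mmap emb v p * mmap emb v q =
    (mmap emb u p - mmap emb v p) * mmap emb u q +
    (mmap emb u q - mmap emb v q) * mmap emb v p by lra.
  by apply: gamma_smallD; exact: gamma_smallM.
Qed.

(** Values at [b] lie in a subfield that meets the small elements only in 0, and differ from the
    values at [a] by small elements. Hence a polynomial vanishing at [gamma], whose value at [a] is
    small, vanishes exactly at [b]. *)
Lemma specialization_point : exists b : 'I_n -> K,
  [/\ forall f, evalS f gamma = 0 -> mmap emb b f = 0,
      forall f, gt0_at f gamma -> 0 < mmap emb b f &
      forall f s, 0 <= s <= 1 -> gt0_at f gamma ->
        0 < mmap emb (fun i => a i + s * (b i - a i)) f].
Proof.
have cvx := gamma_bounded_convex.
pose k0 := range emb.
have emb_bounded c : gamma_bounded (emb c).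
  by rewrite -[emb c](mmapC a emb); exact: ev_bounded.
have sf_k0 : subfield_set k0.
  split.
  - by exists 1; rewrite ?rmorph1.
  - by move=> _ _ [x _ <-] [y _ <-]; exists (x - y); rewrite ?rmorphB.
  - by move=> _ _ [x _ <-] [y _ <-]; exists (x * y); rewrite ?rmorphM.
  - by move=> _ [x _ <-]; exists x^-1; rewrite ?fmorphV.
have k0V : k0 `<=` gamma_bounded by move=> _ [x _ <-]; exact: emb_bounded.
have [k [sf_k kV k0k maxk]] := maximal_subfield sf_k0 k0V.
have residue u : gamma_bounded u -> exists2 b, k b & gamma_small (u - b).
  exact: (maximal_subfield_residue cvx gamma_small0 gamma_smallD gamma_smallM
    gamma_small_le gamma_small_bounded gamma_smallN1 gamma_bounded_inv sf_k kV maxk).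
have a_bounded i : gamma_bounded (a i).
  by rewrite -[a i](mmap1U a) -(mmapX a emb); exact: ev_bounded.
have near_a i : exists b, k b /\ gamma_small (a i - b).
  by have [b kb ab] := residue (a i) (a_bounded i); exists b.
have [b bP] := choice near_a.
have kb f : k (mmap emb b f).
  elim/mpoly_alg_ind: f => [c|i|p q IHp IHq|p q IHp IHq].
  - by rewrite mmapC; apply: k0k; exists c.
  - by rewrite mmapX mmap1U; exact: (bP i).1.
  - rewrite rmorphD /= -[X in _ + X]opprK; apply: (sfB sf_k) => //.
    by rewrite -sub0r; apply: (sfB sf_k) => //; rewrite -(subrr 1); apply: (sfB sf_k);
      exact: (sf1 sf_k).
  - by rewrite rmorphM; exact: (sfM sf_k).
have congr_b f : gamma_small (ev f - mmap emb b f).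
  apply: (mmap_congr f a_bounded _ _).2 => i; last exact: (bP i).2.
  by apply: kV; exact: (bP i).1.
(* If [x] were nonpositive, [ev f] would be at most its distance to [x], hence small. *)
have pos x f : gt0_at f gamma -> gamma_small (ev f - x) -> 0 < x.
  move=> fg sx; rewrite ltNge; apply/negP => x0; apply: (ev_not_small fg).
  apply: gamma_small_le sx; have f0 := gamma_ev fg.
  by rewrite (gtr0_norm f0) ger0_norm; lra.
exists b; split.
- move=> f f0.
  apply: (subfield_meets_m gamma_smallM gamma_smallN1 sf_k kV (kb f)).
  rewrite -[mmap emb b f](subrK (ev f)) -opprB; apply: gamma_smallD.
    by apply: gamma_small_le (congr_b f); rewrite normrN.
  exact: ev_small.
- by move=> f fg; apply: pos fg (congr_b f).
- move=> f s /andP[s0 s1] fg; apply: (pos _ f fg).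
  have seg_small i : gamma_small (a i - (a i + s * (b i - a i))).
    apply: gamma_small_le (bP i).2; rewrite opprD addNKr -mulrN opprB normrM ger0_norm //.
    by rewrite ler_piMl.
  apply: (mmap_congr f a_bounded _ seg_small).2 => i.
  rewrite -[X in gamma_bounded X](subrK (a i)) -[_ - a i]opprB addrC.
  by apply: (cvxB cvx) => //; exact: gamma_small_bounded.
Qed.

End Specialization.

Lemma in_In (T : eqType) (s : seq T) x : x \in s -> List.In x s.
Proof. by elim: s => //= y s IH; rewrite inE => /predU1P[->|/IH]; [left|right]. Qed.

Lemma eq_mmap (n : nat) (R S : comNzRingType) (f : R -> S) (u v : 'I_n -> S) p :
  u =1 v -> mmap f u p = mmap f v p.
Proof. by move=> /funext ->. Qed.

Section SegmentPoints.
Variables (R : rcfType) (n : nat).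
Local Notation A := (mpoly n R).

Lemma mpoly_term (K : rcfType) (emb : {rmorphism R -> K})
    (theta : 'I_n -> qe_rcf.term R) (p : A) : exists h : qe_rcf.term R,
  (forall e, qe_rcf.eval e h = meval (fun i => qe_rcf.eval e (theta i)) p) /\
  (forall e, qe_rcf.eval e (term_map emb h) =
    mmap emb (fun i => qe_rcf.eval e (term_map emb (theta i))) p).
Proof.
elim/mpoly_alg_ind: p => [c|i|p q [h [h1 h2]] [h' [h'1 h'2]]|p q [h [h1 h2]] [h' [h'1 h'2]]].
- by exists (qe_rcf.Const c); split=> e; rewrite ?mevalC ?mmapC.
- by exists (theta i); split=> e; rewrite ?mevalXU ?mmapX ?mmap1U.
- by exists (qe_rcf.Add h h'); split=> e /=; rewrite ?h1 ?h'1 ?h2 ?h'2 rmorphD.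
- by exists (qe_rcf.Mul h h'); split=> e /=; rewrite ?h1 ?h'1 ?h2 ?h'2 rmorphM.
Qed.

Lemma same_sign_ge0 (K : rcfType) (x : K) (y : R) : same_sign x y -> (0 <= x) = (0 <= y).
Proof. by move=> [xy]; rewrite -sgz_ge0 xy sgz_ge0. Qed.

Lemma same_sign_gt0 (K : rcfType) (x : K) (y : R) : same_sign x y -> (0 < x) = (0 < y).
Proof. by move=> [xy]; rewrite -sgz_gt0 xy sgz_gt0. Qed.

Lemma segment_points (delta gamma : sper A) (H : seq A) (g : A) :
  (forall f, gt0_at f gamma -> gt0_at f delta) -> gt0_at g gamma ->
  exists x y : 'I_n -> R,
    [/\ forall h, h \in H -> ge0_at h delta <-> 0 <= meval x h,
        forall h, h \in H -> ge0_at h gamma <-> 0 <= meval y h &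
        forall s, 0 <= s <= 1 -> 0 < meval (fun i => x i + s * (y i - x i)) g].
Proof.
move=> gen gg; have [K [emb [a aP]]] := sper_point delta.
have gamma_ev f : gt0_at f gamma -> 0 < mmap emb a f.
  by move=> /gen/gt0_atP nf; rewrite ltNge -oppr_ge0 -rmorphN; apply/negP => /aP.
have [b [b0 b_gt0 seg_gt0]] := specialization_point gamma_ev.
have bP f : ge0_at f gamma <-> 0 <= mmap emb b f.
  split=> [f0|].
    have [e|fn0] := pselect (evalS f gamma = 0); first by rewrite b0.
    by apply/ltW/b_gt0.
  move=> f0; apply: contrapT => nf; have /b_gt0 : gt0_at (- f) gamma.
    by apply/gt0_atP; rewrite opprK.
  by rewrite rmorphN oppr_gt0 ltNge f0.
(* Variables below [n] hold [a], the next [n] hold [b], and variable [n + n] is kept for the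
   parameter of the segment. *)
pose e := mkseq (fun j => if insub j is Some i then a i else
  if insub (j - n)%N is Some i then b i else 0) (n + n).
have ea (i : 'I_n) : e`_i = a i.
  by rewrite nth_mkseq ?valK // (leq_trans (ltn_ord i)) // leq_addr.
have eb (i : 'I_n) : e`_(n + i) = b i.
  rewrite nth_mkseq ?ltn_add2l // insubF; last by rewrite ltnNge leq_addr.
  by rewrite addKn valK.
pose X (i : 'I_n) : qe_rcf.term R := qe_rcf.Var R i.
pose Y (i : 'I_n) : qe_rcf.term R := qe_rcf.Var R (n + i).
pose S : qe_rcf.term R := qe_rcf.Var R (n + n).
pose Z (i : 'I_n) : qe_rcf.term R :=
  qe_rcf.Add (X i) (qe_rcf.Mul S (qe_rcf.Add (Y i) (qe_rcf.Opp (X i)))).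
have [hx hxP] := choice (mpoly_term emb X).
have [hy hyP] := choice (mpoly_term emb Y).
have [hg [hg1 hg2]] := mpoly_term emb Z g.
pose one_S : qe_rcf.term R := qe_rcf.Add (qe_rcf.NatConst R 1) (qe_rcf.Opp S).
(* Positivity on the whole segment is a universal statement. Agreement on [H'] associates to every
   parameter over [R] one over [K] with the same signs of [S], [1 - S] and [g]. *)
have [H' H'P] := back_and_forth emb [:: S; one_S; hg] (n + n).
have [|xs agr] := @transfer R K emb (@embedding_rcf R K emb) (n + n)
  ((map hx H ++ map hy H) ++ H') e [::].
  by move=> i ni; rewrite nth_nil rmorph0 nth_default // size_mkseq.
have [/agree_cat[agr_x agr_y] agr'] := (agree_cat _ _ _ _ _).1 agr.
exists (fun i => xs`_i), (fun i => xs`_(n + i)); split.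
- move=> h /in_In hH; have := same_sign_ge0 (agr_x (hx h) (List.in_map hx H h hH)).
  rewrite (hxP h).1 (hxP h).2 aP => <-.
  by rewrite (eq_mmap _ _ (ea : (fun i => _) =1 a)).
- move=> h /in_In hH; have := same_sign_ge0 (agr_y (hy h) (List.in_map hy H h hH)).
  rewrite (hyP h).1 (hyP h).2 bP => <-.
  by rewrite (eq_mmap _ _ (eb : (fun i => _) =1 b)).
- move=> s /andP[s0 s1]; have [t agr_t] := (H'P _ _ agr').2 s.
  have := same_sign_ge0 (agr_t S (or_introl erefl)).
  rewrite /= !nth_set_nth /= eqxx s0 => t0.
  have := same_sign_ge0 (agr_t one_S (or_intror (or_introl erefl))).
  rewrite /= !nth_set_nth /= eqxx !subr_ge0 s1 => t1.
  have t01 : 0 <= t <= 1 by rewrite t0 t1.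
  have nset (F : rcfType) (l : seq F) r (i : 'I_n) : (set_nth 0 l (n + n) r)`_i = l`_i
    /\ (set_nth 0 l (n + n) r)`_(n + i) = l`_(n + i).
    rewrite !nth_set_nth /= !ltn_eqF ?ltn_add2l ?(leq_trans (ltn_ord i)) //.
    exact: leq_addr.
  have eqR (i : 'I_n) : qe_rcf.eval (set_nth 0 xs (n + n) s) (Z i) =
      xs`_i + s * (xs`_(n + i) - xs`_i).
    by rewrite /= !(nset _ xs s i).1 !(nset _ xs s i).2 nth_set_nth /= eqxx.
  have eqK (i : 'I_n) : qe_rcf.eval (set_nth 0 e (n + n) t) (term_map emb (Z i)) =
      a i + t * (b i - a i).
    by rewrite /= !(nset _ e t i).1 !(nset _ e t i).2 nth_set_nth /= eqxx ea eb.
  have := same_sign_gt0 (agr_t hg (or_intror (or_intror (or_introl erefl)))).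
  by rewrite hg1 hg2 (eq_mmap _ _ eqK) (meval_eq _ eqR) seg_gt0.
Qed.

End SegmentPoints.

(** * Segments and semialgebraic covers *)

Section Evaluation.
Variables (R : rcfType) (n : nat).
Local Notation A := (mpoly n R).
Implicit Types (q r : A) (x : 'rV[R]_n).

Lemma pevalD q r x : peval (q + r) x = peval q x + peval r x.
Proof. exact: mevalD. Qed.

Lemma pevalM q r x : peval (q * r) x = peval q x * peval r x.
Proof. exact: mevalM. Qed.

Lemma peval1 x : peval (1 : A) x = 1.
Proof. exact: meval1. Qed.

Lemma pevalN q x : peval (- q) x = - peval q x.
Proof. exact: mevalN. Qed.

Lemma pevalB q r x : peval (q - r) x = peval q x - peval r x.
Proof. exact: mevalB. Qed.

End Evaluation.

Section Line.
Variables (R : rcfType) (n : nat).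
Local Notation A := (mpoly n R).

Definition line (x y : 'rV[R]_n) (s : R) : 'rV[R]_n := x + s *: (y - x).

Lemma line_poly (x y : 'rV[R]_n) (p : A) :
  exists q : {poly R}, forall s, q.[s] = peval p (line x y s).
Proof.
elim/mpoly_alg_ind: p => [c|i|p q [u uP] [v vP]|p q [u uP] [v vP]].
- by exists c%:P => s; rewrite hornerC /peval mevalC.
- exists ((x ord0 i)%:P + (y ord0 i - x ord0 i)%:P * 'X) => s.
  by rewrite /peval mevalXU /line !mxE !hornerE mulrC.
- by exists (u + v) => s; rewrite hornerD uP vP pevalD.
- by exists (u * v) => s; rewrite hornerM uP vP pevalM.
Qed.

Lemma line0 (x y : 'rV[R]_n) : line x y 0 = x.
Proof. by rewrite /line scale0r addr0. Qed.

Lemma line1 (x y : 'rV[R]_n) : line x y 1 = y.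
Proof. by rewrite /line scale1r addrC subrK. Qed.

Lemma line_line (x y : 'rV[R]_n) s s' t :
  line (line x y s) (line x y s') t = line x y (s + t * (s' - s)).
Proof. by apply/rowP => i; rewrite /line !mxE; lra. Qed.

Lemma closed_line (P : set 'rV[R]_n) u v : closed P ->
  (forall t, 0 < t < 1 -> P (line u v t)) -> P u.
Proof.
move=> clP Pt; apply: clP => B /nbhs_ballP[e /= e0 eB].
have [M M0 lt_M] : exists2 M, 0 < M & forall i, `|v ord0 i - u ord0 i| < M.
  exists (1 + \sum_(i < n) `|v ord0 i - u ord0 i|).
    by rewrite ltr_pwDl ?ltr01 // sumr_ge0.
  by move=> i; rewrite (bigD1 i) //= ltr_pwDl ?ltr01 // lerDl sumr_ge0.
(* This choice gives both [t < 1] and [t * M < e], so the point is on the open segment and in the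
   ball. *)
pose t := e / (e + M).
have eM : 0 < e + M by rewrite addr_gt0.
have t0 : 0 < t by rewrite divr_gt0.
have t1 : t < 1 by rewrite ltr_pdivrMr // mul1r ltrDl.
exists (line u v t); split; first by apply: Pt; rewrite t0 t1.
apply: eB; split=> // i j; rewrite [i]ord1 /ball /= /ball_ /line !mxE.
rewrite opprD addNKr normrN normrM (gtr0_norm t0).
apply: le_lt_trans (_ : t * M < e); first by rewrite ler_wpM2l ?ltW.
by rewrite /t mulrAC ltr_pdivrMr // mulrDr ltrDr mulr_gt0.
Qed.

Variables (m : nat) (P : 'I_m -> set 'rV[R]_n).
Hypothesis closedP : forall i, closed (P i).
Hypothesis semialgP : forall i, semialgebraic (P i).
Hypothesis coverP : \bigcup_i P i = setT.

Lemma semialgebraic_family : exists H : seq A, forall x y : 'rV[R]_n,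
  (forall p, p \in H -> Num.sg (peval p x) = Num.sg (peval p y)) ->
  forall i, P i x -> P i y.
Proof.
have [L LP] := choice semialgP.
pose polys (i : 'I_m) : seq A := flatten [seq st.1 ++ st.2 | st <- L i].
exists (flatten [seq polys i | i <- enum 'I_m]) => x y sg_xy i.
rewrite LP => -[st stL [eq0 gt0]]; exists st => //.
have mem_H p : p \in st.1 ++ st.2 -> p \in flatten [seq polys i | i <- enum 'I_m].
  move=> pst; apply/flattenP; exists (polys i); first by apply: map_f; rewrite mem_enum.
  by apply/flattenP; exists (st.1 ++ st.2) => //; apply: map_f.
split=> p pst.
  apply/eqP; rewrite -sgr_eq0 -sg_xy ?eq0 ?sgr0 // mem_H // mem_cat pst //.
by rewrite -sgr_gt0 -sg_xy ?sgr_gt0 ?gt0 // mem_H // mem_cat pst orbT.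
Qed.

Variable J : pred 'I_m.

(** Between consecutive roots of the describing polynomials on the line, all signs are constant, so
    each [P i] contains the open interval or misses it. Closedness extends a containing [P i] to
    both ends, and there disjointness forbids changing from [J] to its complement. *)
Lemma line_connected x y :
  (forall t i j, 0 <= t <= 1 -> J i -> ~~ J j ->
     P i (line x y t) -> P j (line x y t) -> False) ->
  forall i j, J i -> ~~ J j -> P i x -> P j y -> False.
Proof.
move=> disj.
have [H HP] := semialgebraic_family.
have [lp lpP] := choice (line_poly x y).
(* Polynomials that vanish on the whole line have constant sign there; leaving them out keeps [q]
   nonzero, with finitely many roots. *)
pose q := \prod_(p <- H | lp p != 0) lp p.
have q0 : q != 0 by rewrite /q; elim/big_rec: _ => [|p r p0 r0]; rewrite ?oner_eq0 ?mulf_neq0.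
pose c s := exists2 i, J i & P i (line x y s).
have dich (s : R) : 0 <= s <= 1 -> ~ c s -> exists2 j, ~~ J j & P j (line x y s).
  move=> s01 nc; have [j _ Pj] : (\bigcup_i P i) (line x y s) by rewrite coverP.
  by exists j => //; apply/negP => Jj; apply: nc; exists j.
have step (s s' : R) : 0 <= s <= 1 -> 0 <= s' <= 1 -> s < s' ->
    (forall r, s < r < s' -> ~~ root q r) -> c s <-> c s'.
  move=> s01 s'01 ss' noroot.
  have same (t t' : R) i : s < t < s' -> s < t' < s' -> P i (line x y t) -> P i (line x y t').
    move=> ts t's; apply: HP => p pH; rewrite -!lpP.
    have [->|p0] := eqVneq (lp p) 0; first by rewrite !horner0.
    apply: (@polyrN0_itv _ `]s, s'[) => // r; rewrite in_itv /= => /noroot.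
    by apply: contraNN => rp; rewrite /q (big_rem p) //= p0 rootM rp.
  pose mid := s + 2%:R^-1 * (s' - s).
  have mid_in : s < mid < s' by rewrite /mid; apply/andP; split; lra.
  have ends i : P i (line x y mid) -> P i (line x y s) /\ P i (line x y s').
    move=> Pi; split.
      apply: (closed_line (v := line x y s') (@closedP i)) => t /andP[t0 t1].
      rewrite line_line; apply: (same mid) => //; apply/andP; split; nra.
    apply: (closed_line (v := line x y s) (@closedP i)) => t /andP[t0 t1].
    rewrite line_line; apply: (same mid) => //; apply/andP; split; nra.
  have [[i Ji /ends[Ps Ps']]|nc] := pselect (c mid).
    by split=> _; exists i.
  have [|j Jj /ends[Ps Ps']] := dich mid _ nc.
    by move: s01 s'01 mid_in => /andP[? ?] /andP[? ?] /andP[? ?]; apply/andP; split; lra.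
  by split=> -[i Ji Pi]; [case: (disj s i j)|case: (disj s' i j)].
(* The interval is split at a root; neither half has this root in its interior, so the count
   decreases. *)
have conn (N : nat) (s s' : R) : (size [seq r : R <- roots q 0 1 | (s < r < s')%R] <= N)%N ->
    0 <= s <= 1 -> 0 <= s' <= 1 -> s < s' -> c s <-> c s'.
  elim: N s s' => [|N IH] s s' szN s01 s'01 ss'.
    apply: step => // r rs; apply/negP => qr.
    move: szN; rewrite leqn0 size_eq0 => /eqP e.
    have : r \in [seq r <- roots q 0 1 | s < r < s'].
      rewrite mem_filter rs in_roots qr q0 andbT in_itv /=.
      by move: s01 s'01 rs => /andP[? ?] /andP[? ?] /andP[? ?]; apply/andP; split; lra.
    by rewrite e.
  have [/hasP[r rq rs]|/hasPn nor] := boolP (has (fun r => s < r < s') (roots q 0 1)).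
    have [sr rs'] := andP rs.
    have r01 : 0 <= r <= 1.
      by move: s01 s'01 => /andP[? ?] /andP[? ?]; apply/andP; split; lra.
    have lt_size (B : pred R) : (forall r', B r' -> s < r' < s') -> ~~ B r ->
        (size [seq r' <- roots q 0 1 | B r'] <= N)%N.
      move=> Bs Br; rewrite -ltnS; apply: leq_trans szN; rewrite !size_filter.
      move: rq; elim: (roots q 0 1) => //= r' l IHl; rewrite inE => /predU1P[<-|/IHl lt].
        by rewrite (negPf Br) rs add0n add1n ltnS; apply: sub_count => w /Bs.
      rewrite -addnS leq_add //; case Br' : (B r') => //.
      by rewrite Bs.
    apply: (iff_trans (IH s r _ s01 r01 sr) (IH r s' _ r01 s'01 rs')); apply: lt_size.
    - by move=> r' /andP[h1 h2]; rewrite h1 (lt_trans h2 rs').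
    - by rewrite ltxx andbF.
    - by move=> r' /andP[h1 h2]; rewrite h2 andbT (lt_trans sr h1).
    - by rewrite ltxx.
  apply: step => // r rs; apply/negP => qr.
  have : r \in roots q 0 1.
    rewrite in_roots qr q0 andbT in_itv /=.
    by move: s01 s'01 rs => /andP[? ?] /andP[? ?] /andP[? ?]; apply/andP; split; lra.
  by move=> /nor; rewrite rs.
move=> i j Ji Jj Pi Pj; have c0 : c 0 by exists i; rewrite ?line0.
have [|||c1 _] := @conn _ 0 1 (leqnn _); rewrite ?lexx ?ler01 ?ltr01 //.
have [i' Ji' Pi'] := c1 c0.
by apply: (disj 1 i' j) => //; rewrite ?lexx ?ler01 ?line1.
Qed.

End Line.

(** * The connectedness conjecture *)

Section SeparatingIdeal.
Variables (A : comNzRingType) (alpha beta : sper A).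

Lemma separating_ideal0 : separating_ideal alpha beta 0.
Proof. by exists 0, (fun=> 0), (fun=> 0); split=> [[]//|]; rewrite big_ord0. Qed.

Lemma separating_idealD f g :
  separating_ideal alpha beta f -> separating_ideal alpha beta g ->
  separating_ideal alpha beta (f + g).
Proof.
move=> [k [a [s [sP ->]]]] [l [b [t [tP ->]]]].
exists (k + l)%N,
  (fun i : 'I_(k + l) => match fintype.split i with inl j => a j | inr j => b j end),
  (fun i : 'I_(k + l) => match fintype.split i with inl j => s j | inr j => t j end).
split=> [i|]; first by case: fintype.split.
rewrite big_split_ord /=; congr (_ + _); apply: eq_bigr => i _.
  by rewrite (unsplitK (inl i)).
by rewrite (unsplitK (inr i)).
Qed.

Lemma separating_idealN f :
  separating_ideal alpha beta f -> separating_ideal alpha beta (- f).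
Proof.
move=> [k [a [s [sP ->]]]]; exists k, (fun i => - a i), s; split=> //.
by rewrite -sumrN; apply: eq_bigr => i _; rewrite mulNr.
Qed.

Lemma separating_ideal_gen f : ge0_at f alpha -> le0_at f beta ->
  separating_ideal alpha beta f.
Proof.
move=> fa fb; exists 1, (fun=> 1), (fun=> f).
by split=> //; rewrite big_ord1 mul1r.
Qed.

(** At [beta] both [f] and [- f] are nonpositive; the one that is nonnegative at [alpha] is a
    generator. *)
Lemma separating_ideal_supp f : evalS f beta = 0 -> separating_ideal alpha beta f.
Proof.
move=> /evalS_eq0[fb nfb]; have [fa|fa] := cone_total (ge0_at_cone alpha) f.
  by apply: separating_ideal_gen => //; apply/le0_atN.
rewrite -[f]opprK; apply/separating_idealN/separating_ideal_gen => //.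
by apply/le0_atN; rewrite opprK.
Qed.

End SeparatingIdeal.

Section Class.
Variables (R : rcfType) (n : nat).
Local Notation A := (mpoly n R).

(** Nonnegativity of both [q] and [- q] determines whether [q] is positive, zero or negative. *)
Definition sign_agree (H : seq A) (gamma : sper A) (x : 'rV[R]_n) : Prop :=
  forall q, q \in H ->
    (ge0_at q gamma <-> 0 <= peval q x) /\ (ge0_at (- q) gamma <-> 0 <= peval (- q) x).

Lemma sign_agree_eq0 H gamma x q : sign_agree H gamma x -> q \in H ->
  evalS q gamma = 0 <-> peval q x = 0.
Proof.
move=> agr /agr[g1 g2]; rewrite evalS_eq0 g1 g2 pevalN oppr_ge0.
by split=> [[h1 h2]|->//]; apply/eqP; rewrite eq_le h1 h2.
Qed.

Lemma sign_agree_gt0 H gamma x q : sign_agree H gamma x -> q \in H ->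
  gt0_at q gamma <-> 0 < peval q x.
Proof.
move=> agr /agr[g1 g2]; rewrite gt0_atP g2 pevalN oppr_ge0.
by rewrite ltNge; split=> /negP.
Qed.

Lemma sign_agree_segment (delta gamma : sper A) (H : seq A) (g : A) :
  (forall f, gt0_at f gamma -> gt0_at f delta) -> gt0_at g gamma ->
  exists x y : 'rV[R]_n, [/\ sign_agree H delta x, sign_agree H gamma y &
    forall s, 0 <= s <= 1 -> 0 < peval g (line x y s)].
Proof.
move=> gen gg.
have [x [y [xP yP gxy]]] := segment_points (H ++ [seq - q | q <- H]) gen gg.
have row_fun (u : 'I_n -> R) h : peval h (\row_i u i) = meval u h.
  by apply: meval_eq => i; rewrite mxE.
exists (\row_i x i), (\row_i y i); split=> [q qH|q qH|s s01].
- by rewrite !row_fun; split; apply: xP; rewrite mem_cat ?qH // map_f ?orbT.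
- by rewrite !row_fun; split; apply: yP; rewrite mem_cat ?qH // map_f ?orbT.
have := gxy s s01; congr (0 < _); apply: meval_eq => i.
by rewrite /line !mxE.
Qed.

(** This is the Artin-Lang theorem, obtained from the trivial specialization of [gamma] to
    itself. *)
Lemma sign_agree_point (gamma : sper A) (H : seq A) : exists x, sign_agree H gamma x.
Proof.
have gt1 : gt0_at (1 : A) gamma by apply/gt0_atP/(coneN1 (ge0_at_cone gamma)).
have [x [y [agr _ _]]] := @sign_agree_segment gamma gamma H 1 (fun f => id) gt1.
by exists x.
Qed.

Variables (m : nat) (P : 'I_m -> set 'rV[R]_n) (p : 'I_m -> A).
Variable L : 'I_m -> seq (seq A * seq A).
Hypothesis LP : forall i, P i = [set x | exists2 st, st \in L i & basic_semialgebraic st x].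
Hypothesis closedP : forall i, closed (P i).
Hypothesis coverP : \bigcup_i P i = setT.
Hypothesis agreeP : forall i j x, P i x -> P j x -> peval (p i) x = peval (p j) x.

Definition tilde (i : 'I_m) : set (sper A) :=
  [set gamma | exists2 st, st \in L i &
    (forall q, q \in st.1 -> evalS q gamma = 0) /\
    (forall q, q \in st.2 -> gt0_at q gamma)].

Definition sign_conditions : seq A :=
  [seq q | i <- enum 'I_m, q <- flatten [seq st.1 ++ st.2 | st <- L i]].

Lemma tildeP H gamma x i : sign_agree (sign_conditions ++ H) gamma x ->
  tilde i gamma <-> P i x.
Proof.
move=> agr; rewrite LP.
have memH st q : st \in L i -> q \in st.1 ++ st.2 -> q \in sign_conditions ++ H.
  move=> stL qst; rewrite mem_cat; apply/orP; left.
  apply/allpairsPdep; exists i, q; split=> //; first by rewrite mem_enum.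
  by apply/flattenP; exists (st.1 ++ st.2) => //; apply: map_f.
split=> -[st stL [eq0 gt0]]; exists st => //; split=> q qst.
- apply/(sign_agree_eq0 agr); last exact: eq0.
  by apply: (memH st) => //; rewrite mem_cat qst.
- apply/(sign_agree_gt0 agr); last exact: gt0.
  by apply: (memH st) => //; rewrite mem_cat qst orbT.
- apply/(sign_agree_eq0 agr); last exact: eq0.
  by apply: (memH st) => //; rewrite mem_cat qst.
- apply/(sign_agree_gt0 agr); last exact: gt0.
  by apply: (memH st) => //; rewrite mem_cat qst orbT.
Qed.

Lemma tilde_cover gamma : exists i, tilde i gamma.
Proof.
have [x agr] := sign_agree_point gamma (sign_conditions ++ [::]).
have [i _ Pi] : (\bigcup_i P i) x by rewrite coverP.
by exists i; apply/(tildeP _ agr).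
Qed.

Lemma tilde_agree gamma i j : tilde i gamma -> tilde j gamma ->
  evalS (p i - p j) gamma = 0.
Proof.
have [x agr] := sign_agree_point gamma (sign_conditions ++ [:: p i - p j]).
move=> /(tildeP _ agr) Pi /(tildeP _ agr) Pj.
apply/(sign_agree_eq0 agr); first by rewrite mem_cat mem_head orbT.
by rewrite pevalB (agreeP Pi Pj) subrr.
Qed.

(** Constructible sets are closed under limits: one of the finitely many systems of [L i] holds on a
    set of [U], and each of its conditions passes to the limit. *)
Lemma tilde_ultra (S : Type) (U : set_system S) (ultraU : UltraFilter U)
    (alpha : S -> sper A) (lim : sper A) i :
  (forall f, ge0_at f lim <-> U [set s | ge0_at f (alpha s)]) ->
  U [set s | tilde i (alpha s)] -> tilde i lim.
Proof.
move=> limP Ui; have [|k Uk] := @ultra_pick _ U 'I_(size (L i)) (fun k => [set s |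
    (forall q, q \in (nth ([::], [::]) (L i) k).1 -> evalS q (alpha s) = 0) /\
    (forall q, q \in (nth ([::], [::]) (L i) k).2 -> gt0_at q (alpha s))]) ultraU.
  apply: filterS Ui => s [st stL [eq0 gt0]].
  have kP : (index st (L i) < size (L i))%N by rewrite index_mem.
  by exists (Ordinal kP); rewrite /= nth_index.
exists (nth ([::], [::]) (L i) k); first exact: mem_nth.
split=> q qk; [apply: (ultra_eq0 ultraU limP)|apply: (ultra_gt0 ultraU limP)];
  apply: filterS Uk => s [eq0 gt0].
  exact: eq0.
exact: gt0.
Qed.

Definition class (J : pred 'I_m) : set (sper A) := [set gamma | exists2 i, J i & tilde i gamma].

Definition separates (J : pred 'I_m) (gamma : sper A) : Prop :=
  forall i j, J i -> ~~ J j -> evalS (p i - p j) gamma <> 0.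

Lemma separatesC J gamma : separates J gamma -> separates (predC J) gamma.
Proof.
move=> sep i j /= Ji /negPn Jj; rewrite -opprB evalSN => /eqP.
by rewrite oppr_eq0 => /eqP; apply: sep.
Qed.

Lemma classC J gamma : separates J gamma -> class (predC J) gamma <-> ~ class J gamma.
Proof.
move=> sep; split=> [[j Jj tj] [i Ji ti]|nJ].
  exact: sep Ji Jj (tilde_agree ti tj).
have [i ti] := tilde_cover gamma; exists i => //=.
by apply/negP => Ji; apply: nJ; exists i.
Qed.

(* Along the segment from a point realizing [delta] to one realizing [gamma] no
   [P i] with [J i] meets a [P j] with [~~ J j], since the polynomial [g] is
   positive on the segment and vanishes where they meet. *)
Lemma class_specialization J delta gamma :
  (forall f, gt0_at f gamma -> gt0_at f delta) -> separates J gamma ->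
  class J delta -> class J gamma.
Proof.
move=> gen sep [i Ji ti]; apply: contrapT => /(classC sep)[j Jj tj].
pose g : A := \prod_(ij : 'I_m * 'I_m | J ij.1 && ~~ J ij.2) (p ij.1 - p ij.2) ^+ 2.
have sq0 (q : A) (alpha : sper A) : ge0_at (q ^+ 2) alpha.
  have [q0|q0] := cone_total (ge0_at_cone alpha) q.
    exact: (coneM (ge0_at_cone alpha)).
  by rewrite expr2; apply: (cone_mulN (ge0_at_cone alpha)).
have gg : gt0_at g gamma.
  rewrite /g; elim/big_rec: _ => [|[k l] r /= /andP[Jk Jl] [r0 nr]].
    exact/gt0_atP/(coneN1 (ge0_at_cone gamma)).
  split; first exact: (coneM (ge0_at_cone gamma)).
  by do 2![apply: evalSM_neq0 => //]; apply: sep.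
have [x [y [agr_x agr_y pos]]] := sign_agree_segment (sign_conditions ++ [::]) gen gg.
have semiP k : semialgebraic (P k) by exists (L k).
apply: (line_connected closedP semiP coverP (J := J) (x := x) (y := y) _ Ji Jj).
- move=> t k l t01 Jk Jl Pk Pl; have := pos t t01.
  rewrite /g (bigD1 (k, l)) /= ?Jk // !pevalM.
  by rewrite pevalB (agreeP Pk Pl) subrr !mul0r ltxx.
- exact/(tildeP _ agr_x).
- exact/(tildeP _ agr_y).
Qed.

(** Otherwise, for each finite list, some point outside the class is positive wherever the list has
    an entry positive at [gamma]. The limit of these points specializes to [gamma], and lies in the
    class of the complement of [J] because finitely many [tilde i] cover. By [class_specialization],
    [gamma] would lie in it too. *)
Lemma class_open J gamma : separates J gamma -> class J gamma ->
  exists s, basic_open s gamma /\ forall delta, basic_open s delta -> class J delta.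
Proof.
move=> sep cJ; apply: contrapT => none.
have bad (s : seq A) : exists delta, basic_open [seq f <- s | `[< gt0_at f gamma >]] delta
    /\ ~ class J delta.
  apply: contrapT => nbad; apply: none.
  exists [seq f <- s | `[< gt0_at f gamma >]]; split=> [f|delta bd].
    by rewrite mem_filter => /andP[/asboolP].
  by apply: contrapT => ncl; apply: nbad; exists delta.
have [delta deltaP] := choice bad.
have [U [ultraU tails]] := ultra_tails A.
have [lim limP] := ultra_sper delta ultraU.
have gen f : gt0_at f gamma -> gt0_at f lim.
  move=> fg; apply: (ultra_gt0 ultraU limP); apply: filterS (tails f) => s fs.
  by apply: (deltaP s).1; rewrite mem_filter fs andbT; apply/asboolP.
have cN : class (predC J) lim.
  have [|i Ui] := @ultra_pick _ U _ (fun i => [set s | ~~ J i /\ tilde i (delta s)]) ultraU.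
    apply: filterS filterT => s _; have [i ti] := tilde_cover (delta s).
    exists i; split=> //; apply/negP => Ji; apply: (deltaP s).2; by exists i.
  have [s0 [Ji _]] := filter_ex Ui.
  exists i => //.
  by apply: (tilde_ultra ultraU limP); apply: filterS Ui => s [].
have := class_specialization gen (separatesC sep) cN.
by move/(classC sep); apply.
Qed.

Hypothesis conn : connectedness_conjecture A.

Lemma connected_separating (alpha beta : sper A) i j :
  tilde i alpha -> tilde j beta -> separating_ideal alpha beta (p j - p i).
Proof.
move=> ti tj.
pose J : pred 'I_m := fun k => `[< separating_ideal alpha beta (p k - p i) >].
pose bad := [seq kl <- enum {: 'I_m * 'I_m} | J kl.1 && ~~ J kl.2].
pose g (e : 'I_(size bad)) : A := p (tnth (in_tuple bad) e).1 - p (tnth (in_tuple bad) e).2.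
have gP e : ~ separating_ideal alpha beta (g e).
  move=> ge; have := mem_tnth e (in_tuple bad); rewrite mem_filter -andbA.
  move=> /and3P[/asboolP Jk /asboolP Jl _]; apply: Jl.
  have -> : p (tnth (in_tuple bad) e).2 - p i = (p (tnth (in_tuple bad) e).1 - p i) - g e.
    by rewrite /g opprB [RHS]addrC addrA subrK.
  by apply: separating_idealD => //; apply: separating_idealN.
have [C [Cconn Calpha Cbeta Cavoid]] := conn gP.
have sep gamma : C gamma -> separates J gamma.
  move=> Cg k l Jk Jl e0.
  have /tnthP[e eE] : (k, l) \in in_tuple bad by rewrite mem_filter /= Jk Jl mem_enum.
  suff : (C `&` zero_locus (g e)) gamma by rewrite Cavoid.
  by split=> //; rewrite /zero_locus /g -eE.
(* This is the interior of the class. On [C] every point is separated, and there it coincides with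
   the class by [class_open]. *)
pose O (K : pred 'I_m) : set (sper A) :=
  [set gamma | exists s, basic_open s gamma /\ basic_open s `<=` class K].
have openO K : open (O K).
  exists [set V | exists s, V = basic_open s /\ V `<=` class K].
    by move=> _ [s [-> _]]; exists s.
  apply/seteqP; split=> [gamma [_ [s [-> sK]] sg]|gamma [s [sg sK]]]; first by exists s.
  by exists (basic_open s) => //; exists s.
have OP K gamma : separates K gamma -> O K gamma <-> class K gamma.
  move=> sepK; split=> [[s [sg]]|/(class_open sepK)//]; exact.
(* The class of [J] is relatively open in [C]; it is relatively closed because its complement in [C]
   is the class of the complement of [J]. *)
have CJ : C `&` class J = C.
  apply: Cconn.
  - exists alpha; split=> //; exists i => //; apply/asboolP.
    by rewrite subrr; exact: separating_ideal0.
  - exists (O J); first exact: openO.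
    by apply/seteqP; split=> gamma [Cg] /(OP J _ (sep _ Cg)).
  - exists (~` O (predC J)); first exact: open_closedC.
    apply/seteqP; split=> gamma [Cg] h; split=> //.
      by move=> /(OP _ _ (separatesC (sep _ Cg)))/(classC (sep _ Cg)).
    apply: contrapT => /(classC (sep _ Cg)) cN.
    by apply: h; apply/(OP _ _ (separatesC (sep _ Cg))).
have : class J beta by have : C beta by []; rewrite -CJ => -[].
move=> [k /asboolP Jk tk].
have -> : p j - p i = (p j - p k) + (p k - p i) by rewrite addrA subrK.
exact/separating_idealD/Jk/separating_ideal_supp/tilde_agree.
Qed.

End Class.

(** * Sup-inf representations *)

Section SupInf.
Variables (R : rcfType) (n : nat) (f : 'rV[R]_n -> R).
Local Notation A := (mpoly n R).

Lemma peval_point : exists point : 'rV[R]_n -> sper A,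
  forall x q, ge0_at q (point x) <-> 0 <= peval q x.
Proof.
have point_at (x : 'rV[R]_n) : exists alpha : sper A, forall q, ge0_at q alpha <-> 0 <= peval q x.
  exact: (pullback_sper (meval (fun i => x ord0 i) : {rmorphism A -> R})).
by have [point pointP] := choice point_at; exists point.
Qed.

Lemma separating_interpolant (F G : set_system 'rV[R]_n) (alpha beta : sper A) (q r : A) :
  UltraFilter F -> UltraFilter G ->
  (forall h, ge0_at h alpha <-> F [set x | 0 <= peval h x]) ->
  (forall h, ge0_at h beta <-> G [set x | 0 <= peval h x]) ->
  separating_ideal alpha beta (q - r) ->
  exists h, F [set x | peval r x <= peval h x] /\ G [set x | peval h x <= peval q x].
Proof.
move=> ultraF ultraG alphaP betaP [k [a [s [sP qr]]]].
have sumP (b : 'I_k -> A) x : peval (\sum_(i < k) b i * s i) x =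
    \sum_(i < k) peval (b i) x * peval (s i) x.
  by rewrite /peval raddf_sum; apply: eq_bigr => i _; exact: pevalM.
(* As [q - r] is the sum of the [a i * s i], the coefficients of [s i] in [h - r] and [h - q] are
   [1 + a i + a i ^+ 2] and [1 + a i ^+ 2]. Both are nonnegative everywhere, while [s i] is
   nonnegative along [F] and nonpositive along [G]. *)
exists (q + \sum_(i < k) (1 + a i ^+ 2) * s i).
have Fs : F [set x | forall i, 0 <= peval (s i) x].
  by apply: filter_forall => i; apply/alphaP; case: (sP i).
have Gs : G [set x | forall i, peval (s i) x <= 0].
  apply: filter_forall => i; have /le0_atN/betaP := (sP i).2.
  by apply: filterS => x /=; rewrite pevalN oppr_ge0.
split; [apply: filterS Fs|apply: filterS Gs] => x /= sx.
  have := congr1 (fun h => peval h x) qr; rewrite pevalB sumP => /eqP.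
  rewrite subr_eq => /eqP e.
  rewrite pevalD e sumP addrAC -big_split /= lerDr.
  apply: sumr_ge0 => i _; rewrite -mulrDl mulr_ge0 // pevalD peval1 expr2 pevalM.
  nra.
rewrite pevalD sumP gerDl; apply: sumr_le0 => i _; apply: mulr_ge0_le0 => //.
by rewrite pevalD peval1 expr2 pevalM; nra.
Qed.

Lemma max_fin_eq m (F : 'I_m.+1 -> R) y :
  (forall i, F i <= y) -> (exists i, y <= F i) -> y = max_fin F.
Proof.
move=> Fy [i yF]; apply/eqP; rewrite eq_le /max_fin; apply/andP; split.
  exact: le_trans yF (le_bigmax _ _ _).
by apply/bigmax_leP; split.
Qed.

Lemma le_min_fin m (F : 'I_m.+1 -> R) y : (forall i, y <= F i) -> y <= min_fin F.
Proof. by move=> yF; rewrite /min_fin; apply/bigmin_geP; split. Qed.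

Lemma min_fin_le m (F : 'I_m.+1 -> R) i : min_fin F <= F i.
Proof. exact: bigmin_le. Qed.

Lemma sup_inf_of_seqs (S : seq (seq A)) :
  (forall s, s \in S -> forall x, exists2 h, h \in s & peval h x <= f x) ->
  (forall x, exists2 s, s \in S & forall h, h \in s -> f x <= peval h x) ->
  exists (m k : nat) (g : 'I_m.+1 -> 'I_k.+1 -> A),
    forall x, f x = max_fin (fun i => min_fin (fun j => peval (g i j) x)).
Proof.
move=> infS supS.
have S0 : (0 < size S)%N by have [s] := supS 0; case: (S).
pose k := (\max_(s <- S) size s)%N.
(* Rows of different lengths are padded with their own first entry, which leaves the minimum
   unchanged. *)
pose g (i : 'I_(size S).-1.+1) (j : 'I_k.+1) : A :=
  let s := nth [::] S i in nth (head 0 s) s j.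
have memS (i : 'I_(size S).-1.+1) : nth [::] S i \in S.
  by apply: mem_nth; rewrite -[X in (_ < X)%N](prednK S0).
exists (size S).-1, k, g => x; apply: max_fin_eq => [i|].
  have [h hs hf] := infS _ (memS i) x.
  have jk : (index h (nth [::] S i) < k.+1)%N.
    rewrite ltnS; apply: leq_trans (ltnW _) (leq_bigmax_seq _ (memS i) isT).
    by rewrite index_mem.
  apply: le_trans (min_fin_le _ (Ordinal jk)) _.
  by rewrite /g /= nth_index.
have [s sS fs] := supS x.
have iS : (index s S < (size S).-1.+1)%N by rewrite prednK // index_mem.
exists (Ordinal iS); apply: le_min_fin => j; apply: fs; rewrite /g /= nth_index //.
have [js|js] := ltnP j (size s); first exact: mem_nth.
rewrite nth_default //.
have [h hs _] := infS s sS x.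
by case: (s) hs => // u l _; rewrite mem_head.
Qed.

(** For fixed [F], compactness in [G] gives finitely many [h] above [f] on sets of [F], one of them
    below [f] at each point. Their minimum is at most [f] everywhere and at least [f] on a set of
    [F]. Compactness in [F] then leaves finitely many such minima, whose maximum is [f]. *)
Lemma sup_inf_of_interpolation :
  (forall F G : set_system 'rV[R]_n, UltraFilter F -> UltraFilter G ->
     exists h : A, F [set x | f x <= peval h x] /\ G [set x | peval h x <= f x]) ->
  exists (m k : nat) (g : 'I_m.+1 -> 'I_k.+1 -> A),
    forall x, f x = max_fin (fun i => min_fin (fun j => peval (g i j) x)).
Proof.
move=> interp.
pose low (s : seq A) := forall x, exists2 h, h \in s & peval h x <= f x.
pose up (s : seq A) x := forall h, h \in s -> f x <= peval h x.
have row F : UltraFilter F -> exists s, F [set x | low s /\ up s x].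
  move=> ultraF.
  have [G ultraG|s sP] := @ultra_compact _ A (fun h => [set x |
      F [set x | f x <= peval h x] /\ peval h x <= f x]).
    have [h [Fh Gh]] := interp F G ultraF ultraG; exists h.
    by apply: filterS Gh => x.
  pose s' := [seq h <- s | `[< F [set x | f x <= peval h x] >]].
  exists s'; have Fs' : F [set x | forall i : 'I_(size s'), f x <= peval (nth 0 s' i) x].
    apply: filter_forall => i; have : nth 0 s' i \in s' by apply: mem_nth.
    by rewrite mem_filter => /andP[/asboolP].
  apply: filterS Fs' => x fx; split=> [y|h hs'].
    have [h hs [Fh hy]] := sP y; exists h => //.
    by rewrite mem_filter hs andbT; apply/asboolP.
  have hi : (index h s' < size s')%N by rewrite index_mem.
  by have := fx (Ordinal hi); rewrite /= nth_index.
have [S SP] := ultra_compact row.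
apply: (@sup_inf_of_seqs [seq s <- S | `[< low s >]]) => [s|x].
  by rewrite mem_filter => /andP[/asboolP].
have [s sS [lows ups]] := SP x; exists s => //.
by rewrite mem_filter sS andbT; apply/asboolP.
Qed.

End SupInf.

Theorem theorem2p1 (R : rcfType) (n : nat) :
  connectedness_conjecture (mpoly n R) -> pierce_birkhoff_conjecture R n.
Proof.
move=> conn f [m [P [p [closed_semialg coverP fP]]]].
have [L LP] := choice (fun i => (closed_semialg i).2).
have closedP i : closed (P i) by case: (closed_semialg i).
have agreeP i j x : P i x -> P j x -> peval (p i) x = peval (p j) x.
  by move=> /fP <- /fP.
have [pt ptP] := peval_point R n.
(* The index [i] serves twice: [tilde L i] contains the limit point, and [f] equals [p i] on a set
   of [F], so that bounds for [p i] become bounds for [f]. *)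
have limit (F : set_system 'rV[R]_n) : UltraFilter F -> exists (alpha : sper (mpoly n R)) i,
    [/\ forall h, ge0_at h alpha <-> F [set x | 0 <= peval h x], tilde L i alpha & F (P i)].
  move=> ultraF; have [alpha alphaP] := ultra_sper pt ultraF.
  have [|i Fi] := @ultra_pick _ F _ P ultraF.
    by apply: filterS filterT => x _; have [i _ Pi] : (\bigcup_i P i) x; [rewrite coverP|exists i].
  exists alpha, i; split=> // [h|].
    by rewrite alphaP; split; apply: filterS => x /ptP.
  apply: (tilde_ultra ultraF alphaP); apply: filterS Fi => x.
  have agr : sign_agree (sign_conditions L ++ [::]) (pt x) x by move=> q _; rewrite !ptP.
  by move=> /(tildeP LP _ agr).
apply: sup_inf_of_interpolation => F G ultraF ultraG.
have [alpha [i [alphaP ti Fi]]] := limit F ultraF.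
have [beta [j [betaP tj Gj]]] := limit G ultraG.
have sep := connected_separating LP closedP coverP agreeP conn ti tj.
have [h [Fh Gh]] := separating_interpolant ultraF ultraG alphaP betaP sep.
exists h; split; first by apply: filterS (filterI Fi Fh) => x [/fP /= ->].
by apply: filterS (filterI Gj Gh) => x [/fP /= ->].
Qed.
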